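(* Let $\alpha>0$, $\beta>0$, $c\in\mathbb{R}\setminus\{0\}$, $k\in\mathbb{N}$. Let $\xi\in Stacy(\alpha,\beta;c)$ and let $\tau_1,\ldots,\tau_k$ be random variables such that for every $\lambda>0$, conditionally on $\xi=\lambda$, $\tau_1,\ldots,\tau_k$ are independent and identically $Exp(\lambda)$ distributed. For $n\in\{1,\ldots,k\}$ put $T_n:=\tau_1+\ldots+\tau_n$. Then: (a) $(\tau_1,\tau_2,\ldots,\tau_k)\in Exp\text{-}Stacy\text{-}II(\alpha,\beta;c)$. (b) For $i=1,2,\ldots,k$, $\tau_i\in Exp\text{-}St(\alpha,\beta;c)$. (c) $(\tau_1,\tau_2,\ldots,\tau_k)\stackrel{d}{=}\left(\frac{\eta_1}{\xi},\frac{\eta_2}{\xi},\ldots,\frac{\eta_k}{\xi}\right)$, where $\eta_1,\ldots,\eta_k$ are i.i.d. $Exp(1)$ and independent of $\xi$. (d) $T_n\in Erlang\text{-}St(n;\alpha,\beta;c)$; if $\frac1c\le\alpha$, then $$\mathbb{E}T_n=\frac{n\beta}{\Gamma(\alpha)}\Gamma\left(\alpha-\frac1c\right);$$ and if $\max\left(\frac1c,\frac2c\right)\le\alpha$, then the variance of $T_n$ is $$\mathbb{D}T_n=\frac{n\beta^2}{\Gamma(\alpha)}\left((n+1)\Gamma\left(\alpha-\frac2c\right)-\frac{n}{\Gamma(\alpha)}\Gamma^2\left(\alpha-\frac1c\right)\right).$$ (e) $T_n\stackrel{d}{=}\frac{\eta_1+\eta_2+\ldots+\eta_n}{\xi}$,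 where $\eta_1,\ldots,\eta_n$ are i.i.d. $Exp(1)$ and independent of $\xi$. (f) $T_n\stackrel{d}{=}\frac{\theta_n}{\xi}$, where $\theta_n\in Gamma(n,1)$ is independent of $\xi$. (g) If $a>0$ is a constant, then $aT_n\in Erlang\text{-}St(n;\alpha,a\beta;c)$.
   Context: $\Gamma(\alpha)=\int_0^\infty y^{\alpha-1}e^{-y}\,dy$, with the convention $\Gamma(0)=+\infty$; expectations of nonnegative random variables (and variances) are allowed to be $+\infty$. $\mathbb{D}$ denotes variance, and $\stackrel{d}{=}$ denotes equality in distribution. $\mathbb{N}=\{1,2,\ldots\}$. $\xi\in Stacy(\alpha,\beta;c)$ means that $\xi$ is a positive random variable with probability density function $$P_\xi(x)=|c|\frac{\beta^{c\alpha}}{\Gamma(\alpha)}x^{c\alpha-1}e^{-(\beta x)^c},\quad x>0,$$ and $P_\xi(x)=0$ for $x\le0$. $Exp(\lambda)$, $\lambda>0$, is the exponential distribution with density $\lambda e^{-\lambda t}$, $t>0$. $Gamma(n,1)$ is the distribution with density $\frac{1}{\Gamma(n)}x^{n-1}e^{-x}$, $x>0$. The Krätzel function is $$Z_\rho^\nu(x)=\int_0^\infty y^{\nu-1}e^{-(y^\rho+\frac{x}{y})}\,dy=\int_0^\infty t^{-\nu-1}e^{-(t^{-\rho}+tx)}\,dt,\quad x>0,$$ for $\rho>0$ and any $\nu$, and, when $\rho\le0$, for $\mathrm{Re}(\nu)<0$. $\tau\in Exp\text{-}St(\alpha,\beta;c)$ means that $\tau$ has density $P_\tau(t)=\frac{|c|}{\beta\Gamma(\alpha)}Z_{-c}^{-c\alpha-1}\left(\frac{t}{\beta}\right)$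 for $t>0$ and $0$ for $t\le0$. $(\tau_1,\ldots,\tau_k)\in Exp\text{-}Stacy\text{-}II(\alpha,\beta;c)$ (multivariate Exp-Stacy distribution of the second kind) means that the vector has joint density $$P_{\tau_1,\ldots,\tau_k}(t_1,\ldots,t_k)=\frac{|c|}{\beta^k\Gamma(\alpha)}Z_{-c}^{-c\alpha-k}\left(\frac{t_1+t_2+\ldots+t_k}{\beta}\right)\ \text{ for } t_1>0,\ldots,t_k>0,$$ and $0$ otherwise. $T\in Erlang\text{-}St(n;\alpha,\beta;c)$, $n\in\mathbb{N}$ (Erlang-Stacy distribution), means that $T$ has density $$P_T(t)=\frac{t^{n-1}|c|}{(n-1)!\,\beta^n\Gamma(\alpha)}Z_{-c}^{-c\alpha-n}\left(\frac{t}{\beta}\right)\ \text{ for } t>0,$$ and $0$ for $t\le0$. *)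

(* Defs.v *)
From HB Require Import structures.
From mathcomp Require Import all_boot all_order all_algebra.
From mathcomp Require Import all_classical all_reals all_analysis.

Set Implicit Arguments.
Unset Strict Implicit.
Unset Printing Implicit Defensive.

Import Order.TTheory GRing.Theory Num.Theory.
Import numFieldNormedType.Exports.

Local Open Scope classical_set_scope.
Local Open Scope ring_scope.

(* Lebesgue measure on R^k, as a k-fold product transported along
   R * R^k ~ R^(k+1).  The variant \x^ of the binary product is used because
   only its left factor has to be known to be sigma-finite. *)
Section lebesgue_tuple.
Context {R : realType}.
Local Notation RT := (measurableTypeR R).

Definition cons_pair k (p : RT * k.-tuple RT) : k.+1.-tuple RT :=
  [tuple of p.1 :: p.2].

Lemma measurable_cons_pair k :
  measurable_fun [set: RT * k.-tuple RT] (@cons_pair k).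
Proof. exact: (measurable_cons measurable_fst measurable_snd). Qed.

HB.instance Definition _ k := isMeasurableFun.Build _ _ _ _ (@cons_pair k)
  (@measurable_cons_pair k).

Definition lebesgue_cons k (mu : {measure set (k.-tuple RT) -> \bar R}) :
    set (k.+1.-tuple RT) -> \bar R :=
  pushforward (lebesgue_measure \x^ mu)%E (@cons_pair k).

Section lebesgue_cons_measure.
Variables (k : nat) (mu : {measure set (k.-tuple RT) -> \bar R}).

Let lebesgue_cons0 : lebesgue_cons mu set0 = 0%E.
Proof. by rewrite /lebesgue_cons /pushforward preimage_set0 measure0. Qed.

Let lebesgue_cons_ge0 A : (0 <= lebesgue_cons mu A)%E.
Proof. exact: measure_ge0. Qed.

Let lebesgue_cons_sigma_additive : semi_sigma_additive (lebesgue_cons mu).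
Proof.
exact: (measure_semi_sigma_additive
  (s := pushforward (lebesgue_measure \x^ mu)%E (@cons_pair k))).
Qed.

HB.instance Definition _ := isMeasure.Build _ _ _ (lebesgue_cons mu)
  lebesgue_cons0 lebesgue_cons_ge0 lebesgue_cons_sigma_additive.

End lebesgue_cons_measure.

Fixpoint lebesgue_tuple k : {measure set (k.-tuple RT) -> \bar R} :=
  match k return {measure set (k.-tuple RT) -> \bar R} with
  | 0 => \d_ [tuple]
  | k'.+1 => lebesgue_cons (lebesgue_tuple k')
  end.

End lebesgue_tuple.

Section distributions.
Context {R : realType}.

Definition has_law d d' (T : measurableType d) (T' : measurableType d')
    (P : set T -> \bar R) (X : T -> T') (nu : set T' -> \bar R) : Prop :=
  forall A, measurable A -> P (X @^-1` A) = nu A.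

Definition eq_in_law d1 d2 d' (T1 : measurableType d1) (T2 : measurableType d2)
    (T' : measurableType d') (P1 : set T1 -> \bar R) (X1 : T1 -> T')
    (P2 : set T2 -> \bar R) (X2 : T2 -> T') : Prop :=
  forall A, measurable A -> P1 (X1 @^-1` A) = P2 (X2 @^-1` A).

Definition has_density d d' (T : measurableType d) (T' : measurableType d')
    (mu : {measure set T' -> \bar R}) (f : T' -> R) (P : set T -> \bar R)
    (X : T -> T') : Prop :=
  [/\ measurable_fun [set: T'] f, forall x, 0 <= f x &
      has_law P X (fun A => (\int[mu]_(x in A) (f x)%:E)%E)].

Definition independent d d1 d2 (T : measurableType d) (T1 : measurableType d1)
    (T2 : measurableType d2) (P : set T -> \bar R) (X : T -> T1) (Y : T -> T2) :
    Prop :=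
  forall A B, measurable A -> measurable B ->
    P (X @^-1` A `&` Y @^-1` B) = (P (X @^-1` A) * P (Y @^-1` B))%E.

(* The product rule for subfamilies is the case where some A i are setT. *)
Definition mutually_independent d d' (T : measurableType d)
    (T' : measurableType d') (P : set T -> \bar R) k (X : 'I_k -> T -> T') :
    Prop :=
  forall A : 'I_k -> set T', (forall i, measurable (A i)) ->
    P (\bigcap_i (X i @^-1` A i)) = (\prod_(i < k) P (X i @^-1` A i))%E.

Definition iid d d' (T : measurableType d) (T' : measurableType d')
    (P : set T -> \bar R) k (X : 'I_k -> T -> T') (nu : set T' -> \bar R) :
    Prop :=
  mutually_independent P X /\ forall i, has_law P (X i) nu.

(* kappa x is the conditional law of Y given X = x. *)
Definition regular_conditional_law d d1 d2 (T : measurableType d)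
    (T1 : measurableType d1) (T2 : measurableType d2) (P : probability T R)
    (X : {RV P >-> T1}) (Y : T -> T2) (kappa : R.-pker T1 ~> T2) : Prop :=
  forall A B, measurable A -> measurable B ->
    P (X @^-1` A `&` Y @^-1` B) = (\int[distribution P X]_(x in A) kappa x B)%E.

Definition random_vector (T : Type) k (X : 'I_k -> T -> R) (w : T) :
  k.-tuple R := [tuple X i w | i < k].

Definition partial_sum (T : Type) k (X : 'I_k -> T -> R) (n : nat) (w : T) : R :=
  \sum_(i < k | (i < n)%N) X i w.

End distributions.

Section stacy.
Context {R : realType}.

(* Extended-real valued, so that Gamma 0 = +oo; for 0 < a it is finite and
   positive, which is why the densities below may use fine (Gamma a). *)
Definition Gamma (a : R) : \bar R :=
  (\int[lebesgue_measure]_(y in `]0%R, +oo[) (y `^ (a - 1) * expR (- y))%:E)%E.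

Definition Stacy_pdf (a b c x : R) : R :=
  if 0 < x then
    `|c| * (b `^ (c * a) / fine (Gamma a)) * x `^ (c * a - 1)
      * expR (- ((b * x) `^ c))
  else 0.

(* The integral is finite for x > 0 when 0 < rho, or when rho <= 0 and nu < 0;
   outside of this range the value is meaningless. *)
Definition Kratzel (rho nu x : R) : R :=
  \int[lebesgue_measure]_(y in `]0, +oo[)
    (y `^ (nu - 1) * expR (- (y `^ rho + x / y))).

Definition ExpSt_pdf (a b c t : R) : R :=
  if 0 < t then
    `|c| / (b * fine (Gamma a)) * Kratzel (- c) (- (c * a) - 1) (t / b)
  else 0.

Definition ExpStacyII_pdf k (a b c : R) (t : k.-tuple R) : R :=
  if [forall i : 'I_k, 0 < tnth t i] then
    `|c| / (b ^+ k * fine (Gamma a))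
      * Kratzel (- c) (- (c * a) - k%:R) ((\sum_(i < k) tnth t i) / b)
  else 0.

Definition ErlangSt_pdf (n : nat) (a b c t : R) : R :=
  if 0 < t then
    t ^+ n.-1 * `|c| / ((n.-1)`!%:R * b ^+ n * fine (Gamma a))
      * Kratzel (- c) (- (c * a) - n%:R) (t / b)
  else 0.

Definition Gamma_pdf (n : nat) (x : R) : R :=
  if 0 < x then (fine (Gamma n%:R))^-1 * x ^+ n.-1 * expR (- x) else 0.

Section predicates.
Context d (T : measurableType d) (P : probability T R).

Definition Stacy (a b c : R) (X : T -> R) : Prop :=
  P [set w | 0 < X w] = 1%E /\
  has_density lebesgue_measure (Stacy_pdf a b c) P X.

Definition ExpSt (a b c : R) (X : T -> R) : Prop :=
  has_density lebesgue_measure (ExpSt_pdf a b c) P X.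

Definition ExpStacyII (a b c : R) k (X : 'I_k -> T -> R) : Prop :=
  has_density (lebesgue_tuple k) (ExpStacyII_pdf a b c) P (random_vector X).

Definition ErlangSt (n : nat) (a b c : R) (X : T -> R) : Prop :=
  has_density lebesgue_measure (ErlangSt_pdf n a b c) P X.

(* The Gamma(n, 1) distribution. *)
Definition Gamma_n1 (n : nat) (X : T -> R) : Prop :=
  has_density lebesgue_measure (Gamma_pdf n) P X.

End predicates.

End stacy.

(* Main.v *)
From HB Require Import structures.
Require Import Defs.
From mathcomp Require Import all_boot all_order all_algebra.
From mathcomp Require Import all_classical all_reals all_analysis.
From mathcomp Require Import measurable_realfun.
From mathcomp Require Import ring lra.

(** Conditionally on xi = x the vector tau has density the product of the
    x e^(- x t_i), and the partial sum of its first n entries has the Erlang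
    density x^n t^(n-1) / (n-1)! e^(- x t).  So each law asked for is a mixture

      P(Y in A) = int p(x) (int_A g(x, t) dt) dx,

    where p is the Stacy density, and Tonelli's theorem turns it into a density
    t |-> int p(x) g(x, t) dx ([mixture_has_density]).  In every case g(x, t) is
    x^n e^(- s x) times a function of t, and the Laplace integral
    int p(x) x^n e^(- s x) dx is a Kratzel function of s / b after the
    substitution y = 1 / (b x) ([Stacy_Laplace]): this gives (a), (b) and the
    density in (d), and (g) is a scaling of it.

    Moments come from the same double integral read in the other order.  The
    inner integral of t^m against the Erlang density is
    (n+m-1)! / (n-1)! x^(-m), and int p(x) x^(-m) dx is
    b^m Gamma(a - m/c) / Gamma(a) by the substitution y = (b x)^c
    ([ErlangSt_moment]).  The variance needs a finite mean only, so that the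
    case of an infinite second moment is covered.

    For (c), (e), (f), independence allows conditioning on xi' = y
    ([independent_disintegration]), and an Exp(1) or Gamma(n, 1) variable divided
    by y has the conditional law found above for tau or for its sums: both
    sides are the same mixture ([ratio_vector_law], [ratio_law]).

    Two tools serve throughout.  A finite measure on k-tuples is determined by its
    values on rectangles ([tuple_measure_unique]), so that independence of
    identically distributed coordinates is a product density for the k-fold
    Lebesgue measure ([iid_density]).  On the half line every substitution
    x = s y^r is affine in the logarithmic variable, where it is the
    invariance of Lebesgue measure up to a factor ([ge0_integral_affine],
    [ge0_integral_ln]); this treats both signs of c at once. *)

Set Implicit Arguments.
Unset Strict Implicit.
Unset Printing Implicit Defensive.

Import Order.TTheory GRing.Theory Num.Theory.
Import numFieldNormedType.Exports.

Local Open Scope classical_set_scope.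
Local Open Scope ring_scope.

(** * Measures with a density, images, and substitutions on the half line *)

Section density_measure.
Local Open Scope ereal_scope.
Context d (T : measurableType d) (R : realType).
Variables (mu : {measure set T -> \bar R}) (p : T -> R).
Hypotheses (mp : measurable_fun [set: T] p) (p_ge0 : forall x, (0 <= p x)%R).

Let density A := \int[mu]_(x in A) (p x)%:E.

Let density0 : density set0 = 0.
Proof. by rewrite /density integral_set0. Qed.

Let density_ge0 A : 0 <= density A.
Proof. by apply: integral_ge0 => x _; rewrite lee_fin. Qed.

Let density_sigma_additive : semi_sigma_additive density.
Proof.
move=> /= F mF tF mUF; rewrite /density; apply: cvg_toP.
  apply: ereal_nondecreasing_is_cvgn => m n mn.
  by apply: lee_sum_nneg_natr => // k _ _; exact: density_ge0.
rewrite ge0_integral_bigcup//=.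
- exact/measurable_funTS/measurable_EFinP.
- by move=> x _; rewrite lee_fin.
Qed.

HB.instance Definition _ := isMeasure.Build _ _ _
  density density0 density_ge0 density_sigma_additive.

Definition density_measure : {measure set T -> \bar R} := density.

Lemma density_measureE A : density_measure A = \int[mu]_(x in A) (p x)%:E.
Proof. by []. Qed.

Import HBNNSimple.

Let ge0_integral_density_indic E : measurable E ->
  \int[density_measure]_x (\1_E x)%:E = \int[mu]_x ((p x)%:E * (\1_E x)%:E).
Proof.
move=> mE; rewrite integral_indic// setIT density_measureE integral_mkcond.
by apply: eq_integral => x _; rewrite epatch_indic.
Qed.

Let ge0_integral_density_nnsfun (h : {nnsfun T >-> R}) :
  \int[density_measure]_x (h x)%:E = \int[mu]_x ((p x)%:E * (h x)%:E).
Proof.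
under [LHS]eq_integral do rewrite fimfunE -fsumEFin//.
rewrite [LHS]ge0_integral_fsum//; last 2 first.
  - by move=> r; exact/measurable_EFinP/measurableT_comp.
  - by move=> n x _; rewrite EFinM nnfun_muleindic_ge0.
under [RHS]eq_integral.
  move=> x xD; rewrite fimfunE -fsumEFin// ge0_mule_fsumr; last first.
    by move=> r; rewrite EFinM nnfun_muleindic_ge0.
  over.
rewrite [RHS]ge0_integral_fsum//; last 2 first.
  - move=> r; apply: emeasurable_funM; first exact/measurable_EFinP.
    by apply/measurable_EFinP; exact/measurableT_comp.
  - move=> r x _; apply: mule_ge0; first by rewrite lee_fin.
    by rewrite EFinM nnfun_muleindic_ge0.
apply: eq_fsbigr => r _.
have [r0|r0] := ltP r 0%R.
  rewrite !integral0_eq// => x _; rewrite preimage_nnfun0// indicE in_set0.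
    by rewrite mulr0 mule0.
  by rewrite mulr0.
transitivity (\int[mu]_x (r%:E * ((p x)%:E * (\1_(h @^-1` [set r]) x)%:E))); last first.
  by apply: eq_integral => x _; rewrite /= EFinM muleCA.
rewrite ge0_integralZl//; last 2 first.
- apply: emeasurable_funM; exact/measurable_EFinP.
- by move=> x _; rewrite mule_ge0// lee_fin.
rewrite -ge0_integral_density_indic// -ge0_integralZl//.
exact/measurable_EFinP.
Qed.

(** Both sides are monotone limits along simple functions, on which the identity
    is the definition of the measure. *)
Lemma ge0_integral_density (f : T -> \bar R) :
    measurable_fun [set: T] f -> (forall x, 0 <= f x) ->
  \int[density_measure]_x f x = \int[mu]_x ((p x)%:E * f x).
Proof.
move=> mf f0; pose f_ := nnsfun_approx measurableT mf.
transitivity (limn (fun n => \int[density_measure]_x (f_ n x)%:E)).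
  rewrite -monotone_convergence//.
  - apply: eq_integral => x _; apply/esym/cvg_lim => //.
    exact: cvg_nnsfun_approx.
  - by move=> n; exact/measurable_EFinP.
  - by move=> n x _; rewrite lee_fin.
  - by move=> x _ m n mn; rewrite lee_fin; exact/lefP/nd_nnsfun_approx.
under eq_fun do rewrite ge0_integral_density_nnsfun.
rewrite -monotone_convergence//.
- apply: eq_integral => x _; apply/cvg_lim => //.
  by apply: cvgeZl => //; exact: cvg_nnsfun_approx.
- move=> n; apply: emeasurable_funM; first exact/measurable_EFinP.
  exact/measurable_EFinP.
- by move=> n x _; rewrite mule_ge0// lee_fin.
- move=> x _ m n mn; rewrite lee_wpmul2l// lee_fin//.
  exact/lefP/nd_nnsfun_approx.
Qed.

End density_measure.

(** The pushforward together with its measure structure, which depends on the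
    proof that the map is measurable. *)
Definition image_measure d d' (T1 : measurableType d) (T2 : measurableType d')
    (R : realType) (mu : {measure set T1 -> \bar R}) (phi : T1 -> T2)
    (mphi : measurable_fun [set: T1] phi) : {measure set T2 -> \bar R}.
Proof. by refine (pushforward mu phi : {measure set T2 -> \bar R}). Defined.

Lemma ge0_integral_image d d' (T1 : measurableType d) (T2 : measurableType d')
    (R : realType) (mu : {measure set T1 -> \bar R}) (phi : T1 -> T2)
    (mphi : measurable_fun [set: T1] phi) (f : T2 -> \bar R) :
    measurable_fun [set: T2] f -> (forall x, 0 <= f x)%E ->
  (\int[image_measure mu mphi]_x f x = \int[mu]_x f (phi x))%E.
Proof. by move=> mf f0; rewrite [LHS]ge0_integral_pushforward. Qed.

(** On each half line the inverse is a real power, up to sign. *)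
Lemma measurable_invr (R : realType) : measurable_fun [set: R] (GRing.inv : R -> R).
Proof.
apply: (eq_measurable_fun
    (fun y : R => if 0 <= y then y `^ (-1) else - ((- y) `^ (-1)))).
  move=> y _; case: ifP => [y0|/negbT]; first by rewrite powR_inv1.
  by rewrite -ltNge => y0; rewrite powR_inv1 ?oppr_ge0 ?ltW// invrN opprK.
apply: measurable_fun_ifT => /=.
- exact: measurable_fun_ler.
- exact: measurable_powR.
- have mopp : measurable_fun [set: R] (-%R : R -> R) by exact: oppr_measurable.
  exact: (measurableT_comp mopp (measurableT_comp (measurable_powR (-1)) mopp)).
Qed.

Section substitution.
Local Open Scope ereal_scope.
Context {R : realType}.
Local Notation mu := (@lebesgue_measure R).
Local Notation RT := (measurableTypeR R).
Implicit Types f : R -> \bar R.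

(** The rescaled image of Lebesgue measure gives intervals their length, hence
    is Lebesgue measure; when r is negative the image exchanges the open and the
    closed end of an interval, which does not change its length. *)
Lemma ge0_integral_affine (r q : R) f : r != 0%R ->
    measurable_fun [set: R] f -> (forall x, 0 <= f x) ->
  \int[mu]_x f x = `|r|%:E * \int[mu]_x f (r * x + q)%R.
Proof.
move=> r0 mf f0.
pose phi (x : RT) : RT := (r * x + q)%R.
have mphi : measurable_fun [set: RT] phi.
  by apply: measurable_funD => //; apply: measurable_funM.
pose m := mscale (NngNum (normr_ge0 r)) (image_measure mu mphi).
have muE A : measurable A -> mu A = m A.
  apply: lebesgue_measure_unique => /= _ [[a b]] _ <-.
  rewrite /m /= /mscale /= /pushforward /=.
  have [rpos|rneg|] := ltgtP 0%R r; last by move=> r00; rewrite -r00 eqxx in r0.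
  - rewrite (_ : phi @^-1` _ = [set` `](a - q) / r, (b - q) / r]%R]); last first.
      apply/seteqP; split => x /=; rewrite !in_itv/= /phi;
      by rewrite ltr_pdivrMr// ler_pdivlMr// ltrBlDr lerBrDr (mulrC x).
    rewrite !lebesgue_measure_itv/= !lte_fin ltr_pM2r ?invr_gt0// ltrBlDr subrK.
    case: ifPn => // ab; last by rewrite mule0.
    rewrite -EFinD -EFinM gtr0_norm//; congr _%:E; field; exact: lt0r_neq0.
  - rewrite (_ : phi @^-1` _ = [set` `[(b - q) / r, (a - q) / r[%R]); last first.
      apply/seteqP; split => x /=; rewrite !in_itv/= /phi;
      by rewrite ler_ndivrMr// ltr_ndivlMr// ltrBlDr lerBrDr (mulrC x) andbC.
    rewrite !lebesgue_measure_itv/= !lte_fin ltr_nM2r ?invr_lt0// ltrBlDr subrK.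
    case: ifPn => // ab; last by rewrite mule0.
    rewrite -EFinD -EFinM ltr0_norm//; congr _%:E; field; exact: ltr0_neq0.
transitivity (\int[m]_x f x).
  by apply: eq_measure_integral => A mA _; exact: muE.
by rewrite ge0_integral_mscale//= ge0_integral_image.
Qed.

(** The logarithm carries the measure dx / x of the half line to Lebesgue measure:
    by the fundamental theorem of calculus the interval from e^a to e^b has
    mass b - a. *)
Lemma ge0_integral_ln f :
    measurable_fun [set: R] f -> (forall x, 0 <= f x) ->
  \int[mu]_x f x = \int[mu]_(x in `]0%R, +oo[) ((x^-1)%:E * f (ln x)).
Proof.
move=> mf f0.
pose p (x : RT) : R := ((GRing.inv : R -> R) \_ (`]0%R, +oo[%classic : set R)) x.
have mp : measurable_fun [set: RT] p.
  apply/(measurable_restrict _ _) => //; rewrite setTI; apply: measurable_funTS.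
  exact: (@measurable_invr R).
have p0 x : (0 <= p x)%R.
  by apply: restrict_ge0 => {}x /=; rewrite in_itv/= andbT invr_ge0; exact: ltW.
have mln : measurable_fun [set: RT] (@ln R : RT -> RT) by exact: measurable_ln.
pose m := image_measure (density_measure mu mp p0) mln.
have muE A : measurable A -> mu A = m A.
  apply: lebesgue_measure_unique => /= _ [[a b]] /= _ <-.
  rewrite /m /= /pushforward /=.
  rewrite lebesgue_measure_itv/= lte_fin integral_mkcond.
  have [ab|ba] := ltP a b; last first.
    rewrite integral0_eq// => x _; rewrite patchE; case: ifPn => // /set_mem/=.
    by rewrite in_itv/= => /andP[/lt_le_trans h /h]; rewrite ltNge ba.
  (* The preimage of an interval under the logarithm is taken inside the half
     line, because the logarithm is also defined on nonpositive numbers. *)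
  have pos (x : R) : x \in `]expR a, expR b[%R -> (0 < x)%R.
    by rewrite in_itv/= => /andP[/(lt_trans (expR_gt0 a))].
  have cpos (x : R) : x \in `[expR a, expR b]%R -> (0 < x)%R.
    by rewrite in_itv/= => /andP[/(lt_le_trans (expR_gt0 a))].
  transitivity (\int[mu]_(x in [set` `]expR a, expR b]%R]) (x^-1)%:E).
    rewrite integral_itv_obnd_cbnd; last first.
      apply/measurable_EFinP; apply: measurable_funTS.
      exact: (@measurable_invr R).
    rewrite (@continuous_FTC2 _ _ (@ln R)) ?expRK ?ltr_expR//.
    - apply: continuous_in_subspaceT => x /set_mem/= /cpos x0.
      by apply: inv_continuous; rewrite gt_eqF.
    - split.
      + by move=> x /pos x0; have [] := is_derive1_ln x0.
      + apply: cvg_at_right_filter; apply: continuous_ln; exact: expR_gt0.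
      + apply: cvg_at_left_filter; apply: continuous_ln; exact: expR_gt0.
    - by move=> x /pos x0; rewrite derive1E; have [_ ->] := is_derive1_ln x0.
  rewrite [LHS]integral_mkcond; apply: eq_integral => x _.
  rewrite !patchE /p patchE !mem_setE !in_itv/= andbT.
  have [x0|x0] := ltP 0%R x.
    by rewrite -{1 2}(lnK x0) ltr_expR ler_expR.
  rewrite ifF; last by apply/negbTE; rewrite negb_and -leNgt (le_trans x0)// expR_ge0.
  by case: ifP.
transitivity (\int[m]_x f x).
  by apply: eq_measure_integral => A mA _; exact: muE.
rewrite ge0_integral_image// ge0_integral_density//=; last exact: measurableT_comp.
rewrite [RHS]integral_mkcond; apply: eq_integral => x _ /=.
by rewrite /p !patchE; case: ifPn => //; rewrite mul0e.
Qed.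

End substitution.

(** * Measures on tuples and independent coordinates *)

Section tuple_rectangles.
Context d (T : measurableType d) (k : nat).
Implicit Types A : 'I_k -> set T.

Definition rectangle A : set (k.-tuple T) := [set t | forall i, A i (tnth t i)].

Lemma rectangle_bigcap A :
  rectangle A = \bigcap_i ((fun t : k.-tuple T => tnth t i) @^-1` A i).
Proof. by apply/seteqP; split => t tA i; [move=> _|have := tA i I]; first exact: tA. Qed.

Lemma measurable_rectangle A :
  (forall i, measurable (A i)) -> measurable (rectangle A).
Proof.
move=> mA; rewrite rectangle_bigcap.
apply: fin_bigcap_measurable; first exact: finite_finset.
by move=> i _; rewrite -[X in measurable X]setTI; exact: measurable_tnth.
Qed.

Lemma measurable_tuple_rectangles (B : set (k.-tuple T)) : measurable B ->
  <<s [set C | exists A, (forall i, measurable (A i)) /\ C = rectangle A] >> B.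
Proof.
set G := [set C | _]; apply: smallest_sub => /=; first exact: smallest_sigma_algebra.
apply: (big_ind (fun S : set (set (k.-tuple T)) => S `<=` <<s G >>)).
- exact: sub0set.
- by move=> S1 S2 S1G S2G; rewrite subUset.
- move=> i _ _ [A mA <-]; apply: sub_sigma_algebra.
  exists (fun j => if j == i then A else setT); split.
    by move=> j; case: ifP.
  rewrite setTI; apply/seteqP; split => t /= tA.
    by move=> j; case: ifPn => // /eqP ->.
  by have := tA i; rewrite eqxx.
Qed.

(** Rectangles are stable under intersection and generate the sigma-algebra, so
    that two finite measures agreeing on them are equal. *)
Lemma tuple_measure_unique (R : realType) (m1 m2 : {measure set (k.-tuple T) -> \bar R}) :
    (m1 setT < +oo)%E ->
    (forall A, (forall i, measurable (A i)) -> m1 (rectangle A) = m2 (rectangle A)) ->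
  forall B, measurable B -> m1 B = m2 B.
Proof.
move=> m1oo m12 B /measurable_tuple_rectangles mB.
apply: (g_sigma_algebra_measure_unique _ _ (fun=> setT)) mB => //.
- by move=> _ /= [A [mA ->]]; exact: measurable_rectangle.
- move=> _; exists (fun=> setT); split => //.
  by apply/seteqP; split.
- by rewrite bigcup_const//; exists 0%N.
- move=> _ _ /= [A [mA ->]] [A' [mA' ->]]; exists (fun i => A i `&` A' i).
  split; first by move=> i; exact: measurableI.
  apply/seteqP; split => t /=; first by move=> [tA tA'] i; split.
  by move=> tAA'; split => i; case: (tAA' i).
- by move=> _ /= [A [mA ->]]; exact: m12.
Qed.

End tuple_rectangles.

Section lebesgue_tuple_theory.
Local Open Scope ereal_scope.
Context {R : realType}.
Local Notation RT := (measurableTypeR R).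
Local Notation mu := (@lebesgue_measure R).

(** The k-fold Lebesgue measure under a name of its own, on which sigma-finiteness
    is declared: Tonelli's theorem asks for it. *)
Definition lebt k : set (k.-tuple RT) -> \bar R := lebesgue_tuple k.
HB.instance Definition _ k := Measure.copy (@lebt k) (lebesgue_tuple k).

Lemma rectangleS k (A : 'I_k.+1 -> set RT) :
  @cons_pair R k @^-1` rectangle A =
  A ord0 `*` rectangle (fun i => A (lift ord0 i)).
Proof.
apply/seteqP; split => -[x t] /=.
  by move=> tA; split => [|i]; [have := tA ord0|have := tA (lift ord0 i); rewrite tnthS].
by move=> [Ax tA] i; case: (unliftP ord0 i) => [j ->|->//]; rewrite tnthS; exact: tA.
Qed.

Lemma lebt_rectangle k (A : 'I_k -> set RT) : (forall i, measurable (A i)) ->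
  lebt (rectangle A) = \prod_(i < k) mu (A i).
Proof.
elim: k A => [|k IH] A mA.
  rewrite big_ord0 /lebt /= /dirac indicE mem_set//=.
  by move=> [].
rewrite big_ord_recl -IH//.
rewrite {1}/lebt /= /lebesgue_cons /pushforward rectangleS.
by rewrite product_measure2E//; apply: measurable_rectangle => i; exact: mA.
Qed.

(** Cubes of finite volume exhaust the space of tuples. *)
Let lebt_sigma_finite k : sigma_finite setT (@lebt k).
Proof.
exists (fun n => rectangle (fun=> [set` `[- n%:R, n%:R]%R] : set RT)).
  apply/seteqP; split => // t _.
  have [n tn] : exists n : nat, forall i : 'I_k, (`|tnth t i : R| <= n%:R)%R.
    exists (\max_(i < k) (Num.bound `|tnth t i : R|%R))%N => i.
    apply/ltW; apply: (lt_le_trans (archi_boundP (normr_ge0 _))).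
    by rewrite ler_nat; exact: (@leq_bigmax _ (fun i => Num.bound `|tnth t i : R|%R) i).
  by exists n => // i /=; rewrite in_itv/= -ler_norml.
move=> n; split; first by apply: measurable_rectangle => i.
rewrite lebt_rectangle//.
suff /andP[] : (0 <= \prod_(i < k) mu [set` `[- n%:R, n%:R]%R]) &&
  (\prod_(i < k) mu [set` `[- n%:R, n%:R]%R] < +oo) by [].
apply: (big_ind (fun x => (0 <= x) && (x < +oo))).
- by rewrite lee_fin ler01 ltry.
- move=> x y /andP[x0 xoo] /andP[y0 yoo]; rewrite mule_ge0//=.
  by apply: lte_mul_pinfty => //; rewrite ge0_fin_numE.
- move=> i _; rewrite measure_ge0/= lebesgue_measure_itv/=.
  by case: ifPn => // _; rewrite -EFinD ltry.
Qed.

HB.instance Definition _ k := Measure_isSigmaFinite.Build _ _ _ (@lebt k)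
  (@lebt_sigma_finite k).

End lebesgue_tuple_theory.

Section lebesgue_tuple_integral.
Local Open Scope ereal_scope.
Context {R : realType}.
Local Notation RT := (measurableTypeR R).
Local Notation mu := (@lebesgue_measure R).

(** The recursion defining the k-fold measure swaps the roles of the two factors
    of the usual product measure; both products agree as they are sigma-finite. *)
Lemma ge0_integral_lebtS k (F : k.+1.-tuple RT -> \bar R) :
    measurable_fun [set: k.+1.-tuple RT] F -> (forall t, 0 <= F t) ->
  \int[lebt (k:=k.+1)]_t F t =
  \int[mu]_x \int[lebt (k:=k)]_t F [tuple of x :: t].
Proof.
move=> mF F0.
pose m := image_measure (mu \x @lebt R k) (@measurable_cons_pair R k).
transitivity (\int[m]_t F t).
  apply: eq_measure_integral => B mB _.
  rewrite /lebt /= /lebesgue_cons /pushforward.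
  apply/esym; apply: product_measure_unique => [A1 A2 mA1 mA2|].
    exact: product_measure2E.
  by rewrite -[X in measurable X]setTI; exact: measurable_cons_pair.
rewrite ge0_integral_image//.
rewrite (@fubini_tonelli1 _ _ _ _ _ mu (lebt (k:=k)) (F \o @cons_pair R k))//.
  by apply: measurableT_comp => //; exact: measurable_cons_pair.
by move=> x; exact: F0.
Qed.

Lemma measurable_prod_tnth k (h : 'I_k -> R -> R) :
    (forall i, measurable_fun [set: R] (h i)) ->
  measurable_fun [set: k.-tuple RT] (fun t => \prod_(i < k) h i (tnth t i))%R.
Proof.
move=> mh; apply: measurable_prod => i _.
by apply: (measurableT_comp (mh i)); exact: measurable_tnth.
Qed.

Lemma integral_lebt_prod k (h : 'I_k -> R -> R) :
    (forall i, measurable_fun [set: R] (h i)) ->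
    (forall i x, (0 <= h i x)%R) ->
  \int[lebt (k:=k)]_t (\prod_(i < k) h i (tnth t i))%:E =
  \prod_(i < k) \int[mu]_x (h i x)%:E.
Proof.
elim: k h => [|k IH] h mh h0.
  rewrite big_ord0; under eq_integral do rewrite big_ord0.
  by rewrite integral_cst// mul1e; exact: diracT.
rewrite big_ord_recl ge0_integral_lebtS; last 2 first.
- by apply/measurable_EFinP; exact: measurable_prod_tnth.
- by move=> t; rewrite lee_fin; exact: prodr_ge0.
rewrite -IH//.
transitivity (\int[mu]_x ((h ord0 x)%:E *
    \int[lebt (k:=k)]_t (\prod_(i < k) h (lift ord0 i) (tnth t i))%:E)).
  apply: eq_integral => x _; rewrite -ge0_integralZl//.
  - apply: eq_integral => t _; rewrite big_ord_recl EFinM; congr (_ * _%:E).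
    by apply: eq_bigr => i _; rewrite tnthS.
  - apply/measurable_EFinP.
    exact: (measurable_prod_tnth (h := fun i => h (lift ord0 i))).
  - by move=> t _; rewrite lee_fin; exact: prodr_ge0.
  - by rewrite lee_fin.
rewrite ge0_integralZr//.
- by apply/measurable_EFinP; exact: mh.
- by move=> x _; rewrite lee_fin.
- by apply: integral_ge0 => t _; rewrite lee_fin; exact: prodr_ge0.
Qed.

(** This is how independence is turned into a density: the product density
    and m give the same mass to each rectangle. *)
Lemma iid_density k (m : {measure set (k.-tuple RT) -> \bar R}) (h : R -> R) :
    measurable_fun [set: R] h -> (forall x, (0 <= h x)%R) ->
    m setT < +oo ->
    (forall A, (forall i, measurable (A i)) -> m (rectangle A) =
      \prod_(i < k) \int[mu]_(x in A i) (h x)%:E) ->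
  forall B, measurable B ->
    m B = \int[lebt (k:=k)]_(t in B) (\prod_(i < k) h (tnth t i))%:E.
Proof.
move=> mh h0 moo mE B mB.
pose p (t : k.-tuple RT) := (\prod_(i < k) h (tnth t i))%R.
have mp : measurable_fun [set: k.-tuple RT] p.
  exact: (@measurable_prod_tnth k (fun=> h)).
have p0 t : (0 <= p t)%R by exact: prodr_ge0.
rewrite -[RHS](density_measureE (lebt (k:=k)) mp p0).
apply: tuple_measure_unique mB => // A mA.
rewrite mE// density_measureE integral_mkcond.
transitivity (\int[lebt (k:=k)]_t
    (\prod_(i < k) (h (tnth t i) * \1_(A i) (tnth t i)))%:E).
  rewrite (integral_lebt_prod (h := fun i x => h x * \1_(A i) x)%R).
  - apply: eq_bigr => i _; rewrite integral_mkcond; apply: eq_integral => x _.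
    by rewrite patchE indicE; case: ifPn => _; rewrite ?mulr1 ?mulr0.
  - move=> i; apply: measurable_funM => //.
    by apply: (@measurable_indic _ RT R setT (A i)); exact: mA.
  - by move=> i x; rewrite mulr_ge0.
apply: eq_integral => t _; rewrite big_split/= patchE; case: ifPn => [/set_mem tA|].
  rewrite [X in (_ * X)%R]big1 ?mulr1// => i _.
  by rewrite indicE mem_set//; exact: tA.
move=> /negP tA.
have [i Ai] : exists i, ~ A i (tnth t i).
  by apply/existsNP => h'; apply: tA; rewrite inE.
by rewrite [X in (_ * X)%R](bigD1 i)//= indicE memNset// mul0r mulr0.
Qed.

End lebesgue_tuple_integral.

(** * Erlang densities and sums of exponential variables *)

Section Erlang.
Context {R : realType}.
Local Notation RT := (measurableTypeR R).
Local Notation mu := (@lebesgue_measure R).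
Implicit Types (l t u : R) (n : nat).

(** The rate l is guarded too, so that the function is nonnegative and jointly
    measurable in (l, t), as mixtures over l require. *)
Definition Erlang_pdf n l t : R :=
  if (0 < l) && (0 < t) then
    l ^+ n * (t ^+ n.-1 / (n.-1)`!%:R) * expR (- (l * t))
  else 0.

Lemma Erlang_pdf_ge0 n l t : 0 <= Erlang_pdf n l t.
Proof.
rewrite /Erlang_pdf; case: ifP => // /andP[l0 t0].
by rewrite !mulr_ge0 ?expR_ge0 ?exprn_ge0 ?invr_ge0 ?ler0n// ltW.
Qed.

Lemma measurable_Erlang_pdf2 n :
  measurable_fun [set: R * R] (fun z => Erlang_pdf n z.1 z.2).
Proof.
apply: measurable_fun_ifT => /=.
- by apply: measurable_and; apply: measurable_fun_ltr.
- apply: measurable_funM.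
    apply: measurable_funM; first by apply: measurable_funX.
    by apply: measurable_funM => //; apply: measurable_funX.
  apply: measurableT_comp => //; apply: measurableT_comp => //.
  exact: measurable_funM.
- exact: measurable_cst.
Qed.

Lemma measurable_Erlang_pdf n l : measurable_fun [set: R] (Erlang_pdf n l).
Proof. exact: (measurableT_comp (measurable_Erlang_pdf2 n) (measurable_pair1 l)). Qed.

(** The primitive that computes the convolution of an exponential and an Erlang
    density. *)
Lemma is_derive_subX n (C u x : R) :
  is_derive x 1 (fun x => - C * ((u - x) ^+ n.+1 / n.+1`!%:R)) (C * ((u - x) ^+ n / n`!%:R)).
Proof.
have -> : (fun x => - C * ((u - x) ^+ n.+1 / n.+1`!%:R)) =
    (- C / n.+1`!%:R) *: ((cst u - @id R) ^+ n.+1 : R -> R).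
  by apply/funext => y /=; rewrite /GRing.scale/= fctE mulrCA mulrC.
apply: is_derive_eq.
rewrite /GRing.scale/= fctE/=.
rewrite [(- id) x]/(- x) factS natrM; field.
by rewrite nat1r !pnatr_eq0 -lt0n fact_gt0.
Qed.

Lemma continuous_subX n (C u : R) :
  continuous (fun x : R => C * ((u - x) ^+ n / n`!%:R)).
Proof.
move=> x; apply: (@continuousM _ R^o (fun=> C) (fun x => (u - x) ^+ n / n`!%:R)).
  exact: cst_continuous.
apply: (@continuousM _ R^o (fun x => (u - x) ^+ n) (fun=> n`!%:R^-1)); last first.
  exact: cst_continuous.
apply: (@continuous_comp _ _ _ (fun x : R^o => u - x) (fun y : R => y ^+ n)).
  2: exact: exprn_continuous.
apply: (@continuousB _ R^o R^o (fun=> u) (fun x => x)); first exact: cst_continuous.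
exact: cvg_id.
Qed.

Lemma measurable_sum_tnth k n : measurable_fun [set: k.-tuple RT]
  (fun t : k.-tuple RT => \sum_(i < k | (i < n)%N) (tnth t i : R)).
Proof.
apply: (eq_measurable_fun (fun t : k.-tuple RT =>
    \sum_(i < k) (if (i < n)%N then (tnth t i : R) else 0))).
  by move=> t _; rewrite [RHS]big_mkcond.
apply: measurable_sum => i; case: (i < n)%N; last exact: measurable_cst.
exact: measurable_tnth.
Qed.

Local Open Scope ereal_scope.

(** The two densities differ at t = 0 only: here the support is open. *)
Lemma exponential_probE l A : (0 < l)%R -> measurable A ->
  exponential_prob l A = \int[mu]_(t in A) (Erlang_pdf 1 l t)%:E.
Proof.
move=> l0 mA; rewrite /exponential_prob.
have mA0 : measurable (A `\ 0%R) by exact: measurableD.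
rewrite -(integral_setD1 (r := 0%R)); last 2 first.
- by [].
- apply/measurable_EFinP; apply: measurable_funTS.
  exact: measurable_exponential_pdf.
rewrite -[RHS](integral_setD1 (r := 0%R)); last 2 first.
- by [].
- apply/measurable_EFinP; apply: measurable_funTS.
  exact: measurable_Erlang_pdf.
apply: eq_integral => t; rewrite inE /= => -[_ /eqP t0].
rewrite /Erlang_pdf l0/= expr1 expr0 fact0 divr1 mulr1.
have [t1|t1] := ltP 0%R t.
  by rewrite exponential_pdfE ?mulNr//; exact: ltW.
by rewrite lt0_exponential_pdf// lt_neqAle t0.
Qed.

Lemma integral_Erlang_pdf1 l : (0 < l)%R ->
  \int[mu]_t (Erlang_pdf 1 l t)%:E = 1.
Proof.
by move=> l0; rewrite -exponential_probE// /exponential_prob integral_exponential_pdf.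
Qed.

(** For 0 < x < u the exponential factors multiply to e^(- l u), which does not
    depend on x; what remains is the integral of (u - x)^n / n!. *)
Lemma Erlang_conv n l u : (0 < l)%R ->
  \int[mu]_x ((Erlang_pdf 1 l x)%:E * (Erlang_pdf n.+1 l (u - x))%:E) =
  (Erlang_pdf n.+2 l u)%:E.
Proof.
move=> l0.
pose K := (l ^+ n.+2 * expR (- (l * u)))%R.
transitivity (\int[mu]_(x in [set` `]0%R, u[%R]) (K * ((u - x) ^+ n / n`!%:R))%:E).
  rewrite [RHS]integral_mkcond; apply: eq_integral => x _.
  rewrite patchE mem_setE in_itv/= -EFinM /Erlang_pdf l0/= subr_gt0.
  case: (ltP 0%R x) => x0; last by rewrite mul0r.
  case: (ltP x u) => xu; last by rewrite mulr0.
  congr _%:E; rewrite /K expr1 expr0 fact0 divr1 mulr1.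
  have -> : expR (- (l * u)) = (expR (- (l * x)) * expR (- (l * (u - x))))%R.
    by rewrite -expRD; congr expR; ring.
  by rewrite !exprS; ring.
have [u0|u0] := leP u 0%R.
  rewrite /Erlang_pdf l0 ltNge u0/= set_itv_ge ?integral_set0//.
  by rewrite bnd_simp -leNgt.
pose F (x : R) := (- K * ((u - x) ^+ n.+1 / n.+1`!%:R))%R.
have dF (x : R) := is_derive_subX n K u x.
have cF : continuous F by exact: (@continuous_subX n.+1 (- K)%R u).
have cf := @continuous_subX n K u.
rewrite -(@integral_itv_bndoo _ _ _ _ true false); last first.
  by apply/measurable_EFinP/measurable_funTS; exact: continuous_measurable_fun.
rewrite (@continuous_FTC2 _ _ F)//.
- rewrite /F -EFinB subrr expr0n/= mul0r mulr0 sub0r subr0 mulNr opprK.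
  by rewrite /Erlang_pdf l0 u0/= /K; congr _%:E; ring.
- exact: continuous_subspaceT.
- split.
  + by move=> x _; have [] := dF x.
  + by apply: cvg_at_right_filter; exact: cF.
  + by apply: cvg_at_left_filter; exact: cF.
- by move=> x _; rewrite derive1E; have [_ ->] := dF x.
Qed.

(** Splitting off the first coordinate x of the tuple turns the statement into the
    one for n - 1 and the translate of phi by x; translating back and exchanging
    the integrals leaves the convolution [Erlang_conv].  The function phi is
    arbitrary because the induction translates it. *)
Lemma integral_Erlang_sum k n l (phi : R -> \bar R) : (0 < l)%R -> (n < k)%N ->
    measurable_fun [set: R] phi -> (forall t, 0 <= phi t) ->
  \int[lebt (k:=k)]_t ((\prod_(i < k) Erlang_pdf 1 l (tnth t i))%:E *
      phi (\sum_(i < k | (i < n.+1)%N) tnth t i)%R) =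
  \int[mu]_s ((Erlang_pdf n.+1 l s)%:E * phi s).
Proof.
move=> l0.
have mE m : measurable_fun [set: R] (EFin \o Erlang_pdf m l).
  by apply/measurable_EFinP; exact: measurable_Erlang_pdf.
have E0 m t : 0 <= (Erlang_pdf m l t)%:E by rewrite lee_fin Erlang_pdf_ge0.
have mprod k' : measurable_fun [set: k'.-tuple RT]
    (fun t : k'.-tuple RT => (\prod_(i < k') Erlang_pdf 1 l (tnth t i))%:E).
  apply/measurable_EFinP; apply: (measurable_prod_tnth (h := fun=> Erlang_pdf 1 l)) => _.
  exact: measurable_Erlang_pdf.
have prod0 k' (t : k'.-tuple RT) : 0 <= (\prod_(i < k') Erlang_pdf 1 l (tnth t i))%:E.
  by rewrite lee_fin; apply: prodr_ge0 => i _; exact: Erlang_pdf_ge0.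
have mshift (x : R) : measurable_fun [set: R] (fun s : R => x + s)%R.
  exact: measurable_funD.
have head k' m (psi : R -> \bar R) : measurable_fun [set: R] psi -> (forall t, 0 <= psi t) ->
  \int[lebt (k:=k'.+1)]_t ((\prod_(i < k'.+1) Erlang_pdf 1 l (tnth t i))%:E *
      psi (\sum_(i < k'.+1 | (i < m.+1)%N) tnth t i)%R) =
  \int[mu]_x ((Erlang_pdf 1 l x)%:E * \int[lebt (k:=k')]_t
      ((\prod_(i < k') Erlang_pdf 1 l (tnth t i))%:E *
      psi (x + \sum_(i < k' | (i < m)%N) tnth t i)%R)).
  move=> mpsi psi0; rewrite ge0_integral_lebtS; last 2 first.
  - apply: emeasurable_funM; first exact: mprod.
    by apply: (measurableT_comp mpsi); exact: measurable_sum_tnth.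
  - by move=> t; rewrite mule_ge0.
  apply: eq_integral => x _; rewrite -ge0_integralZl//; last 2 first.
  - apply: emeasurable_funM; first exact: mprod.
    apply: (measurableT_comp mpsi); apply: (measurableT_comp (mshift x)).
    exact: measurable_sum_tnth.
  - by move=> t _; rewrite mule_ge0.
  apply: eq_integral => t _; rewrite big_ord_recl.
  rewrite [X in psi X]big_mkcond [X in psi X]big_ord_recl/=.
  rewrite EFinM -muleA; congr (_ * (_%:E * psi (_ + _)%R)).
    by apply: eq_bigr => i _; rewrite tnthS.
  rewrite [RHS]big_mkcond; apply: eq_bigr => i _.
  by rewrite tnthS.
elim: n k phi => [|n IH] [//|k] phi nk mphi phi0; rewrite head//.
  apply: eq_integral => x _; congr (_ * _).
  have x0 (t : k.-tuple RT) : (x + \sum_(i < k | (i < 0)%N) tnth t i = x)%R.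
    by rewrite [X in (_ + X)%R]big_pred0// addr0.
  under eq_integral do rewrite x0.
  rewrite ge0_integralZr//; last exact: mprod.
  rewrite (integral_lebt_prod (h := fun=> Erlang_pdf 1 l)).
  - rewrite (eq_bigr (fun=> 1)) ?big1_eq ?mul1e// => i _.
    exact: integral_Erlang_pdf1.
  - by move=> _; exact: measurable_Erlang_pdf.
  - by move=> _ y; exact: Erlang_pdf_ge0.
have msub : measurable_fun [set: R * R] (fun z : R * R => z.2 - z.1)%R.
  by apply: measurable_funB.
have mconv : measurable_fun [set: R * R] (fun z : R * R => (Erlang_pdf 1 l z.1)%:E *
    ((Erlang_pdf n.+1 l (z.2 - z.1))%:E * phi z.2)).
  apply: emeasurable_funM; first exact: (measurableT_comp (mE 1%N)).
  apply: emeasurable_funM; last exact: (measurableT_comp mphi).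
  exact: (measurableT_comp (mE n.+1)).
transitivity (\int[mu]_x \int[mu]_s
   ((Erlang_pdf 1 l x)%:E * ((Erlang_pdf n.+1 l (s - x))%:E * phi s))).
  apply: eq_integral => x _.
  have mphix : measurable_fun [set: R] (fun s => phi (x + s)%R).
    exact: (measurableT_comp mphi).
  rewrite (IH k (fun s => phi (x + s)%R))//.
  rewrite (ge0_integral_affine (r := 1) (- x)%R)//; last 2 first.
  - by apply: emeasurable_funM; [exact: mE|exact: mphix].
  - by move=> s; rewrite mule_ge0.
  have maff : measurable_fun [set: R] (fun s : R => 1 * s + - x)%R.
    by apply: measurable_funD => //; exact: measurable_funM.
  have mEphi : measurable_fun [set: R] (fun s : R =>
      (Erlang_pdf n.+1 l (1 * s + - x))%:E * phi (x + (1 * s + - x))%R).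
    apply: emeasurable_funM; first exact: (measurableT_comp (mE n.+1) maff).
    exact: (measurableT_comp mphix maff).
  rewrite normr1 mul1e -ge0_integralZl;
    [|exact: measurableT|exact: mEphi| |exact: E0]; last first.
    by move=> s _; apply: mule_ge0.
  apply: eq_integral => s _; rewrite mul1r; congr (_ * (_ * phi _)).
  by rewrite addrC subrK.
rewrite (@fubini_tonelli _ _ _ _ _ mu mu (fun z => (Erlang_pdf 1 l z.1)%:E *
    ((Erlang_pdf n.+1 l (z.2 - z.1))%:E * phi z.2)))/=; last 2 first.
- exact: mconv.
- by move=> z; rewrite !mule_ge0.
apply: eq_integral => s _.
rewrite -Erlang_conv// -ge0_integralZr//; last 2 first.
- have msx : measurable_fun [set: R] (fun x : R => s - x)%R.
    exact: measurable_funB.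
  apply: emeasurable_funM; first exact: mE.
  exact: (measurableT_comp (mE n.+1) msx).
- by move=> x _; rewrite mule_ge0.
by apply: eq_integral => x _; rewrite muleA.
Qed.

(** The Erlang density is that of the sum of n + 1 coordinates, whose product
    density has total mass one. *)
Lemma integral_Erlang_pdf n l : (0 < l)%R ->
  \int[mu]_t (Erlang_pdf n.+1 l t)%:E = 1.
Proof.
move=> l0.
have := @integral_Erlang_sum n.+1 n l (cst 1) l0 (ltnSn _) (measurable_cst _) (fun=> lee01).
under [RHS]eq_integral do rewrite /= mule1.
move=> <-; under eq_integral do rewrite /= mule1.
rewrite (integral_lebt_prod (h := fun=> Erlang_pdf 1 l)).
- by rewrite (eq_bigr (fun=> 1)) ?big1_eq// => i _; exact: integral_Erlang_pdf1.
- by move=> _; exact: measurable_Erlang_pdf.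
- by move=> _ x; exact: Erlang_pdf_ge0.
Qed.

Lemma Erlang_pdf_scale n l t : (0 < l)%R ->
  (l * Erlang_pdf n.+1 1 (l * t) = Erlang_pdf n.+1 l t)%R.
Proof.
move=> l0; rewrite /Erlang_pdf ltr01 l0/= pmulr_rgt0//.
case: ifP => _; last by rewrite mulr0.
by rewrite expr1n !mul1r exprMn exprS !mulrA.
Qed.

Lemma integral_Erlang_scale n l A : (0 < l)%R -> measurable A ->
  \int[mu]_(t in [set t | A (t / l)%R]) (Erlang_pdf n.+1 1 t)%:E =
  \int[mu]_(t in A) (Erlang_pdf n.+1 l t)%:E.
Proof.
move=> l0 mA; rewrite integral_mkcond.
have mAl : measurable [set t | A (t / l)%R].
  have mdiv : measurable_fun [set: R] (fun t : R => t / l)%R.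
    exact: measurable_funM.
  by rewrite -[X in measurable X]setTI; exact: mdiv.
set f := (X in \int[mu]_x X x).
have mf : measurable_fun [set: R] f.
  apply/(measurable_restrictT _ mAl) => //; apply: measurable_funTS.
  by apply/measurable_EFinP; exact: measurable_Erlang_pdf.
have f0 t : 0 <= f t.
  by rewrite /f patchE; case: ifP => // _; rewrite lee_fin Erlang_pdf_ge0.
rewrite (ge0_integral_affine (r := l) 0%R) ?gt_eqF//.
rewrite -ge0_integralZl//; last 2 first.
- have ml : measurable_fun [set: R] (fun t : R => l * t + 0)%R.
    by apply: measurable_funD => //; exact: measurable_funM.
  exact: (measurableT_comp mf ml).
- by move=> t _; exact: f0.
rewrite [RHS]integral_mkcond; apply: eq_integral => t _.
rewrite /f !patchE addr0 gtr0_norm// -(Erlang_pdf_scale n t l0).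
have -> : ((l * t)%R \in [set t | A (t / l)%R]) = (t \in A).
  by apply/idP/idP; rewrite !inE/= mulrAC divff ?gt_eqF// mul1r.
by case: ifP => // _; rewrite mule0.
Qed.

(** A power of t only changes the shape parameter, so moments are quotients of
    normalising constants. *)
Lemma Erlang_pdf_moment m n l t : (0 < l)%R ->
  (t ^+ m * Erlang_pdf n.+1 l t =
   (n + m)`!%:R / n`!%:R / l ^+ m * Erlang_pdf (n + m).+1 l t)%R.
Proof.
move=> l0; rewrite /Erlang_pdf l0/=; case: ifP => t0; last by rewrite !mulr0.
rewrite -addSn !exprD; field.
rewrite expf_neq0 ?gt_eqF//= !pnatr_eq0 -!lt0n !fact_gt0//.
Qed.

Lemma integral_Erlang_moment m n l : (0 < l)%R ->
  \int[mu]_t ((t ^+ m)%:E * (Erlang_pdf n.+1 l t)%:E) =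
  ((n + m)`!%:R / n`!%:R / l ^+ m)%:E.
Proof.
move=> l0; under eq_integral do rewrite -EFinM Erlang_pdf_moment// EFinM.
rewrite ge0_integralZl//.
- by rewrite integral_Erlang_pdf// mule1.
- by apply/measurable_EFinP; exact: measurable_Erlang_pdf.
- by move=> t _; rewrite lee_fin Erlang_pdf_ge0.
- by rewrite lee_fin !divr_ge0// exprn_ge0// ltW.
Qed.

End Erlang.

(** * Gamma, Kratzel and Stacy integrals in the logarithmic variable *)

Section elementary.
Context {R : realType}.

(** Take the n-th root and use 1 + y <= e^y for y = s x / n. *)
Lemma expR_dominates_power n (s x : R) : 0 < s -> 0 < x ->
  x ^+ n * expR (- (s * x)) <= (n%:R / s) ^+ n.
Proof.
move=> s0 x0; case: n => [|n].
  by rewrite !expr0 mul1r expR_le1 oppr_le0 mulr_ge0// ltW.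
have -> : - (s * x) = - (s * x / n.+1%:R) * n.+1%:R by rewrite mulNr divfK.
rewrite expRM_natr -exprMn; apply: lerXn2r; rewrite ?nnegrE.
- by rewrite mulr_ge0 ?expR_ge0// ltW.
- by rewrite divr_ge0// ltW.
rewrite expRN ler_pdivrMr ?expR_gt0// mulrC -ler_pdivrMr ?divr_gt0//.
rewrite (_ : x / (n.+1%:R / s) = s * x / n.+1%:R); last first.
  by field; rewrite nat1r pnatr_eq0 (gt_eqF s0).
by apply: le_trans (expR_ge1Dx _); rewrite lerDr.
Qed.

End elementary.

Section log_scale.
Local Open Scope ereal_scope.
Context {R : realType}.
Local Notation RT := (measurableTypeR R).
Local Notation mu := (@lebesgue_measure R).

Lemma ge0_integral_expR (f : R -> \bar R) :
    measurable_fun [set: R] f -> (forall x, 0 <= f x) ->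
  \int[mu]_(x in `]0%R, +oo[) f x = \int[mu]_u ((expR u)%:E * f (expR u)).
Proof.
move=> mf f0; rewrite [RHS]ge0_integral_ln.
- apply: eq_integral => x; rewrite inE/= in_itv/= andbT => x0.
  by rewrite lnK ?posrE// muleA -EFinM mulVf ?gt_eqF// mul1e.
- apply: emeasurable_funM; first by apply/measurable_EFinP.
  exact: (measurableT_comp mf).
- by move=> u; rewrite mule_ge0// lee_fin expR_ge0.
Qed.

Lemma powR_expR (u p : R) : (expR u `^ p = expR (p * u))%R.
Proof. by rewrite /powR gt_eqF ?expR_gt0// expRK. Qed.

Lemma Gamma_ge0 (z : R) : 0 <= Gamma z.
Proof.
by apply: integral_ge0 => y _; rewrite lee_fin mulr_ge0 ?powR_ge0 ?expR_ge0.
Qed.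

Variables (a b c : R).
Hypotheses (b_gt0 : (0 < b)%R) (c_neq0 : c != 0%R).

(** With x = e^u the Stacy, Gamma and Kratzel integrals all become this one up
    to constants: p collects the exponents of x, including the Jacobian, and s is
    the Laplace variable. *)
Definition log_integral (p s : R) : \bar R :=
  \int[mu]_u (expR (p * u - expR (c * (u + ln b)) - s * expR u))%:E.

Lemma measurable_log_integrand p s : measurable_fun [set: R]
  (fun u => expR (p * u - expR (c * (u + ln b)) - s * expR u))%R.
Proof.
apply: measurableT_comp => //; apply: measurable_funB; last exact: measurable_funM.
apply: measurable_funB; first exact: measurable_funM.
apply: measurableT_comp => //; apply: measurable_funM => //.
exact: measurable_funD.
Qed.

Lemma log_integral_ge0 p s : 0 <= log_integral p s.
Proof. by apply: integral_ge0 => u _; rewrite lee_fin expR_ge0. Qed.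

Lemma powR_mul_expR u : ((b * expR u) `^ c = expR (c * (u + ln b)))%R.
Proof.
by rewrite -{1}(lnK b_gt0) -expRD powR_expR addrC.
Qed.

Lemma Stacy_pdf_ge0 (x : R) : (0 <= Stacy_pdf a b c x)%R.
Proof.
rewrite /Stacy_pdf; case: ifP => // x0.
rewrite !mulr_ge0 ?powR_ge0 ?expR_ge0//.
by rewrite invr_ge0 fine_ge0// Gamma_ge0.
Qed.

Lemma measurable_Stacy_pdf : measurable_fun [set: R] (Stacy_pdf a b c).
Proof.
apply: measurable_fun_ifT => //=; first exact: measurable_fun_ltr.
apply: measurable_funM.
  apply: measurable_funM => //; exact: measurable_powR.
apply: measurableT_comp => //; apply: measurableT_comp => //.
apply: (measurableT_comp (measurable_powR c)).
exact: measurable_funM.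
Qed.

Lemma integral_Stacy_pdf p s :
  \int[mu]_x (Stacy_pdf a b c x * (x `^ p * expR (- (s * x))))%:E =
  (`|c| * (b `^ (c * a) / fine (Gamma a)))%:E * log_integral (c * a + p) s.
Proof.
set K := (`|c| * _)%R.
have K0 : (0 <= K)%R.
  by rewrite mulr_ge0// divr_ge0 ?powR_ge0// fine_ge0// Gamma_ge0.
pose f x := (Stacy_pdf a b c x * (x `^ p * expR (- (s * x))))%:E.
have mf : measurable_fun [set: R] f.
  apply/measurable_EFinP; apply: measurable_funM; first exact: measurable_Stacy_pdf.
  apply: measurable_funM; first exact: measurable_powR.
  by apply: measurableT_comp => //; apply: measurableT_comp => //; exact: measurable_funM.
have f0 x : 0 <= f x.
  by rewrite lee_fin mulr_ge0 ?Stacy_pdf_ge0// mulr_ge0 ?powR_ge0 ?expR_ge0.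
transitivity (\int[mu]_(x in `]0%R, +oo[) f x).
  rewrite [RHS]integral_mkcond; apply: eq_integral => x _.
  rewrite patchE mem_setE in_itv/= andbT /f /Stacy_pdf.
  by case: ifP => // _; rewrite mul0r.
rewrite ge0_integral_expR// -ge0_integralZl ?lee_fin//; last first.
  by apply/measurable_EFinP; exact: measurable_log_integrand.
apply: eq_integral => u _.
rewrite /f /Stacy_pdf expR_gt0 -!EFinM; congr _%:E.
rewrite powR_mul_expR !powR_expR -/K.
rewrite [X in (_ = K * expR X)%R](_ : _ = u + (c * a - 1) * u +
  - expR (c * (u + ln b)) + p * u + - (s * expR u))%R; last by ring.
by rewrite !expRD; ring.
Qed.

(** Here the logarithm of the Gamma variable is c u + c ln b. *)
Lemma Gamma_log p : Gamma (a + p / c) =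
  (`|c| * expR ((c * a + p) * ln b))%:E * log_integral (c * a + p) 0.
Proof.
pose f (y : R) := (y `^ (a + p / c - 1) * expR (- y))%:E.
have mf : measurable_fun [set: R] f.
  apply/measurable_EFinP; apply: measurable_funM; first exact: measurable_powR.
  exact: measurableT_comp.
have f0 y : 0 <= f y by rewrite lee_fin mulr_ge0 ?powR_ge0 ?expR_ge0.
rewrite /Gamma (ge0_integral_expR (f := f))//.
rewrite (ge0_integral_affine (r := c) (c * ln b)%R)//; last 2 first.
- apply: emeasurable_funM; first by apply/measurable_EFinP.
  exact: (measurableT_comp mf).
- by move=> y; rewrite mule_ge0// lee_fin expR_ge0.
rewrite EFinM -muleA; congr (_ * _).
rewrite -ge0_integralZl ?lee_fin ?expR_ge0//; last first.
  by apply/measurable_EFinP; exact: measurable_log_integrand.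
apply: eq_integral => u _.
rewrite /f powR_expR -!EFinM -!expRD; congr (expR _)%:E.
by rewrite mul0r subr0 !mulrDr; field.
Qed.

(** Here the logarithm of the Kratzel variable is - u - ln b. *)
Lemma Kratzel_log n s : Kratzel (- c) (- (c * a) - n%:R) (s / b) =
  (expR ((c * a + n%:R) * ln b) * fine (log_integral (c * a + n%:R) s))%R.
Proof.
rewrite /Kratzel /Rintegral.
pose f (y : R) :=
  (y `^ (- (c * a) - n%:R - 1) * expR (- (y `^ (- c) + (s / b) * y `^ (-1))))%:E.
have mf : measurable_fun [set: R] f.
  apply/measurable_EFinP; apply: measurable_funM; first exact: measurable_powR.
  apply: measurableT_comp => //; apply: measurableT_comp => //.
  apply: measurable_funD; first exact: measurable_powR.
  apply: measurable_funM => //; exact: measurable_powR.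
have f0 y : 0 <= f y by rewrite lee_fin mulr_ge0 ?powR_ge0 ?expR_ge0.
transitivity (fine (\int[mu]_(y in `]0%R, +oo[) f y)).
  congr fine; apply: eq_integral => y; rewrite inE/= in_itv/= andbT => y0.
  by rewrite /f powR_inv1// ltW.
rewrite (ge0_integral_expR (f := f))//.
rewrite (ge0_integral_affine (r := (-1)%R) (- ln b)%R)// ?oppr_eq0 ?oner_eq0//; last 2 first.
- apply: emeasurable_funM; first by apply/measurable_EFinP.
  exact: (measurableT_comp mf).
- by move=> y; rewrite mule_ge0// lee_fin expR_ge0.
rewrite normrN1 mul1e.
transitivity (fine ((expR ((c * a + n%:R) * ln b))%:E *
    log_integral (c * a + n%:R) s)); last first.
  have := log_integral_ge0 (c * a + n%:R) s.
  case: (log_integral _ _) => [x||]//= _.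
  by rewrite gt0_muley ?mulr0// lte_fin expR_gt0.
congr fine; rewrite -ge0_integralZl ?lee_fin ?expR_ge0//; last first.
  by apply/measurable_EFinP; exact: measurable_log_integrand.
apply: eq_integral => u _; rewrite /f !powR_expR -!EFinM -!expRD; congr (expR _)%:E.
have -> : expR (-1 * (-1 * u - ln b)) = (b * expR u)%R.
  by rewrite -{2}(lnK b_gt0) -expRD; congr expR; ring.
have -> : (- c * (-1 * u - ln b) = c * (u + ln b))%R by ring.
by field; rewrite gt_eqF.
Qed.

Hypothesis Stacy1 : \int[mu]_x (Stacy_pdf a b c x)%:E = 1.

Lemma Stacy_log_integral1 :
  (`|c| * (b `^ (c * a) / fine (Gamma a)))%:E * log_integral (c * a) 0 = 1.
Proof.
have := integral_Stacy_pdf 0 0; rewrite addr0 => <-; rewrite -Stacy1.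
apply: eq_integral => x _; congr _%:E.
have [->|x0] := eqVneq x 0%R; first by rewrite /Stacy_pdf ltxx mul0r.
by rewrite powRr0 mul1r mul0r oppr0 expR0 mulr1.
Qed.

(** If Gamma a were zero or infinite, [fine] would map it to zero and the Stacy
    density would vanish, against its total mass one. *)
Lemma fine_Gamma_gt0 : (0 < fine (Gamma a))%R.
Proof.
rewrite lt_neqAle fine_ge0 ?Gamma_ge0// andbT.
apply/eqP => G0; have := Stacy_log_integral1.
by rewrite -G0 invr0 mulr0 mulr0 mul0e => /eqP; rewrite eqe eq_sym oner_eq0.
Qed.

Lemma Stacy_neg_moment m :
  \int[mu]_x (Stacy_pdf a b c x * x ^- m)%:E =
  (b ^+ m / fine (Gamma a))%:E * Gamma (a - m%:R / c).
Proof.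
transitivity (\int[mu]_x (Stacy_pdf a b c x * (x `^ (- m%:R) * expR (- (0 * x))))%:E).
  apply: eq_integral => x _; rewrite /Stacy_pdf; case: ifP => x0; last by rewrite !mul0r.
  by rewrite mul0r oppr0 expR0 mulr1 powRN powR_mulrn// ltW.
rewrite integral_Stacy_pdf -mulNr Gamma_log muleA -EFinM; congr (_%:E * _).
rewrite /powR gt_eqF// -{2}(lnK b_gt0) -expRM_natr mulrDl expRD.
have -> : expR (- m%:R * ln b) = ((expR (ln b * m%:R))^-1)%R by rewrite -expRN; congr expR; ring.
field.
by rewrite !gt_eqF ?expR_gt0 ?fine_Gamma_gt0.
Qed.

(** The integral is finite because x^n e^(- s x) is bounded; this is needed
    since the Kratzel function is defined through [fine], which maps an infinite
    integral to zero. *)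
Lemma Stacy_Laplace n s : (0 < s)%R ->
  \int[mu]_x (Stacy_pdf a b c x * (x ^+ n * expR (- (s * x))))%:E =
  (`|c| / (b ^+ n * fine (Gamma a)) *
     Kratzel (- c) (- (c * a) - n%:R) (s / b))%:E.
Proof.
move=> s0.
transitivity (\int[mu]_x (Stacy_pdf a b c x * (x `^ n%:R * expR (- (s * x))))%:E).
  apply: eq_integral => x _; rewrite /Stacy_pdf; case: ifP => x0; last by rewrite !mul0r.
  by rewrite powR_mulrn// ltW.
have fin : \int[mu]_x (Stacy_pdf a b c x * (x `^ n%:R * expR (- (s * x))))%:E < +oo.
  pose C := ((n%:R / s) ^+ n)%R.
  apply: (@le_lt_trans _ _ (\int[mu]_x (C%:E * (Stacy_pdf a b c x)%:E))); last first.
    rewrite ge0_integralZl//.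
    - by rewrite Stacy1 mule1 ltry.
    - by apply/measurable_EFinP; exact: measurable_Stacy_pdf.
    - by move=> x _; rewrite lee_fin Stacy_pdf_ge0.
    - by rewrite lee_fin exprn_ge0// divr_ge0// ltW.
  apply: ge0_le_integral => //.
  - by move=> x _; rewrite lee_fin mulr_ge0 ?Stacy_pdf_ge0// mulr_ge0 ?powR_ge0 ?expR_ge0.
  - apply/measurable_EFinP; apply: measurable_funM; first exact: measurable_Stacy_pdf.
    apply: measurable_funM; first exact: measurable_powR.
    by apply: measurableT_comp => //; apply: measurableT_comp => //; exact: measurable_funM.
  - apply/measurable_EFinP; apply: measurable_funM => //; exact: measurable_Stacy_pdf.
  - move=> x _; rewrite -EFinM lee_fin mulrC.
    have [x0|x0] := ltP 0%R x; last by rewrite /Stacy_pdf ltNge x0/= !mulr0.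
    by rewrite ler_wpM2r ?Stacy_pdf_ge0// powR_mulrn ?expR_dominates_power// ltW.
rewrite integral_Stacy_pdf Kratzel_log.
have Lfin : log_integral (c * a + n%:R) s \is a fin_num.
  rewrite ge0_fin_numE ?log_integral_ge0//; move: fin; rewrite integral_Stacy_pdf.
  have := log_integral_ge0 (c * a + n%:R) s.
  case: (log_integral _ _) => [x _ _||]//=; first exact: ltry.
  rewrite gt0_muley ?ltxx// lte_fin.
  by rewrite mulr_gt0 ?normr_gt0// divr_gt0 ?powR_gt0 ?fine_Gamma_gt0.
rewrite -[X in _ * X = _](fineK Lfin) -EFinM; congr _%:E.
rewrite /powR gt_eqF// -{2}(lnK b_gt0) -expRM_natr mulrDl expRD.
have -> : expR (n%:R * ln b) = expR (ln b * n%:R) by rewrite mulrC.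
field.
by rewrite !gt_eqF ?expR_gt0 ?fine_Gamma_gt0.
Qed.

End log_scale.

(** * Mixtures and conditioning on an independent variable *)

Section law.
Local Open Scope ereal_scope.
Context d d' (T : measurableType d) (T' : measurableType d') (R : realType).

Lemma ge0_integral_law (P : {measure set T -> \bar R}) (nu : {measure set T' -> \bar R})
    (f : T' -> R) (X : T -> T') (g : T' -> \bar R) :
    measurable_fun [set: T] X -> has_density nu f P X ->
    measurable_fun [set: T'] g -> (forall x, 0 <= g x) ->
  \int[P]_w g (X w) = \int[nu]_x ((f x)%:E * g x).
Proof.
move=> mX [mf f0 Xf] mg g0.
rewrite -(ge0_integral_density nu mf f0)// -(ge0_integral_image _ mX)//.
by apply: eq_measure_integral => A mA _; exact: Xf.
Qed.

(** Tonelli's theorem, applied to p(x) g(x, t) on the product space.  It also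
    yields the measurability of the density f. *)
Lemma mixture_has_density (Y : T -> T') (P : set T -> \bar R)
    (mu : {sigma_finite_measure set (measurableTypeR R) -> \bar R})
    (nu : {sigma_finite_measure set T' -> \bar R})
    (p : R -> R) (g : R * T' -> R) (f : T' -> R) :
    measurable_fun [set: R] p -> (forall x, (0 <= p x)%R) ->
    measurable_fun [set: R * T'] g -> (forall z, (0 <= g z)%R) ->
    (forall t, \int[mu]_x (p x * g (x, t))%:E = (f t)%:E) ->
    (forall A, measurable A ->
      P (Y @^-1` A) = \int[mu]_x ((p x)%:E * \int[nu]_(t in A) (g (x, t))%:E)) ->
  has_density nu f P Y.
Proof.
move=> mp p0 mg g0 pgf YE.
pose h (z : measurableTypeR R * T') := (p z.1 * g z)%:E.
have mh : measurable_fun [set: measurableTypeR R * T'] h.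
  apply/measurable_EFinP; apply: measurable_funM => //.
  exact: (measurableT_comp mp).
have h0 z : 0 <= h z by rewrite lee_fin mulr_ge0.
have f0 t : (0 <= f t)%R.
  by rewrite -lee_fin -pgf; apply: integral_ge0 => x _; rewrite lee_fin mulr_ge0.
have mf : measurable_fun [set: T'] f.
  apply/measurable_EFinP.
  have := @measurable_fun_fubini_tonelli_G _ _ _ _ _ mu h mh h0.
  by congr measurable_fun; apply/funext => t; exact: pgf.
split=> // A mA; rewrite YE//.
pose hA (z : measurableTypeR R * T') := h z * (\1_A z.2)%:E.
transitivity (\int[mu]_x \int[nu]_t hA (x, t)).
  apply: eq_integral => x _.
  rewrite integral_mkcond -ge0_integralZl ?lee_fin//.
  - apply: eq_integral => t _; rewrite /hA /h/= patchE indicE.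
    by case: ifP => _; rewrite ?mule0// mule1 EFinM.
  - apply/(measurable_restrictT _ mA) => //; apply: measurable_funTS.
    apply/measurable_EFinP; exact: (measurableT_comp mg (measurable_pair1 x)).
  - by move=> t _; rewrite patchE; case: ifP => // _; rewrite lee_fin.
rewrite (fubini_tonelli hA); last 2 first.
- apply: emeasurable_funM => //; apply/measurable_EFinP.
  exact: (measurableT_comp (@measurable_indic _ _ R setT A mA) measurable_snd).
- by move=> z; rewrite mule_ge0// lee_fin.
rewrite [RHS]integral_mkcond; apply: eq_integral => t _.
rewrite patchE /hA/= indicE; case: ifP => _.
  by rewrite -pgf; apply: eq_integral => x _; rewrite mule1.
by rewrite integral0_eq// => x _; rewrite mule0.
Qed.

End law.

Section independence.
Local Open Scope ereal_scope.
Context d d1 d2 (T : measurableType d) (T1 : measurableType d1)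
  (T2 : measurableType d2) (R : realType) (P : probability T R).

(** The joint law is the product of the two laws, and the product measure of a set
    is the integral of the masses of its sections. *)
Lemma independent_disintegration (X : {mfun T >-> T1}) (Y : {mfun T >-> T2})
    (C : set (T1 * T2)) : independent P X Y -> measurable C ->
  P [set w | C (X w, Y w)] = \int[P]_w P [set v | C (X v, Y w)].
Proof.
move=> XY mC.
have mXY : measurable_fun [set: T] (fun w => (X w, Y w)) by exact: measurable_fun_pair.
transitivity ((distribution P X \x distribution P Y) C).
  apply/esym; apply: (@product_measure_unique _ _ _ _ _ _ _ (image_measure P mXY)) => //.
transitivity ((distribution P X \x^ distribution P Y) C).
  apply: product_measure_unique => // A B mA mB.
  exact: product_measure2E.
rewrite /product_measure2 ge0_integral_distribution//=.
- apply: eq_integral => w _; rewrite /= /distribution /pushforward/=; congr (P _).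
  by apply/seteqP; split => v /=; rewrite ysectionE.
- exact: measurable_fun_ysection.
Qed.

End independence.

Section Gamma_finite.
Local Open Scope ereal_scope.
Context {R : realType}.
Local Notation mu := (@lebesgue_measure R).

(** For u < 0 the integrand is at most e^(z u).  For u >= 0 it is at most a
    constant times e^(- u), because e^u >= e^z (1 + u - z) and e^z >= 1 + z. *)
Lemma Gamma_integrand_le (z u : R) : (0 < z)%R ->
  (expR (z * u - expR u) <=
   expR (expR z * (z - 1)) * exponential_pdf 1 u + z^-1 * exponential_pdf z (- u))%R.
Proof.
move=> z0; have [u0|u0] := leP 0%R u.
  apply: (@le_trans _ _ (expR (expR z * (z - 1)) * exponential_pdf 1 u)%R); last first.
    by rewrite lerDl mulr_ge0 ?invr_ge0 ?exponential_pdf_ge0// ltW.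
  rewrite exponential_pdfE// mul1r -expRD ler_expR.
  have h1 : ((1 + z) * u <= expR z * u)%R by rewrite ler_wpM2r// expR_ge1Dx.
  have h2 : (expR z * (1 + (u - z)) <= expR u)%R.
    have -> : (expR u = expR z * expR (u - z))%R by rewrite -expRD; congr expR; ring.
    by rewrite ler_wpM2l ?expR_ge0// expR_ge1Dx.
  by nra.
apply: (@le_trans _ _ (z^-1 * exponential_pdf z (- u))%R); last first.
  by rewrite lerDr mulr_ge0 ?expR_ge0 ?exponential_pdf_ge0.
rewrite exponential_pdfE ?oppr_ge0 ?(ltW u0)// mulrA mulVf ?gt_eqF// mul1r mulrNN ler_expR.
by rewrite gerBl expR_ge0.
Qed.

Lemma Gamma_lt_pinfty (z : R) : (0 < z)%R -> Gamma z < +oo.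
Proof.
move=> z0.
pose f (y : R) := (y `^ (z - 1) * expR (- y))%:E.
have mf : measurable_fun [set: R] f.
  apply/measurable_EFinP; apply: measurable_funM; first exact: measurable_powR.
  exact: measurableT_comp.
have f0 y : 0 <= f y by rewrite lee_fin mulr_ge0 ?powR_ge0 ?expR_ge0.
rewrite /Gamma (ge0_integral_expR (f := f))//.
pose C := expR (expR z * (z - 1)).
have mexp (l : R) : measurable_fun [set: R] (fun u => (exponential_pdf l u)%:E).
  by apply/measurable_EFinP; exact: measurable_exponential_pdf.
have mexpN (l : R) : measurable_fun [set: R] (fun u => (exponential_pdf l (- u))%:E).
  exact: (measurableT_comp (mexp l)).
have intN : \int[mu]_u (exponential_pdf z (- u))%:E = 1.
  rewrite -[RHS](integral_exponential_pdf z0).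
  rewrite [RHS](ge0_integral_affine (r := (-1)%R) 0%R) ?oppr_eq0 ?oner_eq0//.
  - rewrite normrN1 mul1e; apply: eq_integral => u _; congr (exponential_pdf z _)%:E.
    by rewrite addr0 mulN1r.
  - by move=> u; rewrite lee_fin exponential_pdf_ge0// ltW.
apply: (@le_lt_trans _ _ (\int[mu]_u (C%:E * (exponential_pdf 1 u)%:E +
    (z^-1)%:E * (exponential_pdf z (- u))%:E))).
  apply: ge0_le_integral => //.
  - by move=> u _; rewrite mule_ge0// lee_fin expR_ge0.
  - apply: emeasurable_funM; first by apply/measurable_EFinP.
    exact: (measurableT_comp mf).
  - apply: emeasurable_funD.
      by apply: emeasurable_funM; [exact: measurable_cst|exact: mexp].
    by apply: emeasurable_funM; [exact: measurable_cst|exact: mexpN].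
  - move=> u _; rewrite /f powR_expR -!EFinM -EFinD lee_fin.
    apply: le_trans (Gamma_integrand_le u z0); rewrite -!expRD ler_expR le_eqVlt.
    by apply/orP; left; apply/eqP; ring.
rewrite ge0_integralD//.
- rewrite ge0_integralZl;
    [|exact: measurableT|exact: mexp| |by rewrite lee_fin expR_ge0]; last first.
    by move=> u _; rewrite lee_fin exponential_pdf_ge0.
  rewrite ge0_integralZl;
    [|exact: measurableT|exact: mexpN| |by rewrite lee_fin invr_ge0 ltW]; last first.
    by move=> u _; rewrite lee_fin exponential_pdf_ge0// ltW.
  by rewrite integral_exponential_pdf// intN !mule1 -EFinD ltry.
- by move=> u _; rewrite -EFinM lee_fin mulr_ge0 ?expR_ge0 ?exponential_pdf_ge0.
- by apply: emeasurable_funM; [exact: measurable_cst|exact: mexp].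
- by move=> u _; rewrite -EFinM lee_fin mulr_ge0 ?invr_ge0 ?exponential_pdf_ge0// ltW.
- by apply: emeasurable_funM; [exact: measurable_cst|exact: mexpN].
Qed.

End Gamma_finite.

(** * Independent exponential variables and Stacy mixtures *)

Section iid_exponential.
Local Open Scope ereal_scope.
Context d (T : measurableType d) (R : realType).
Variables (P : {measure set T -> \bar R}) (k : nat) (X : 'I_k -> T -> R).
Hypotheses (P1 : P setT = 1) (mX : forall i, measurable_fun [set: T] (X i)).
Local Notation RT := (measurableTypeR R).
Local Notation mu := (@lebesgue_measure R).

Lemma measurable_random_vector :
  measurable_fun [set: T] (random_vector X : T -> k.-tuple RT).
Proof.
apply/measurable_fun_tnthP => i.
rewrite (_ : _ \o _ = X i)//; first exact: mX.
by apply/funext => w /=; rewrite tnth_mktuple.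
Qed.

Variable l : R.
Hypotheses (l_gt0 : (0 < l)%R) (X_iid : iid P X (exponential_prob l)).

Lemma iid_exponential_density (B : set (k.-tuple RT)) : measurable B ->
  P (random_vector X @^-1` B) =
  \int[lebt (k:=k)]_(t in B) (\prod_(i < k) Erlang_pdf 1 l (tnth t i))%:E.
Proof.
move=> mB; have [Xind Xlaw] := X_iid.
apply: (iid_density (m := image_measure P measurable_random_vector)) => //.
- exact: measurable_Erlang_pdf.
- by move=> x; exact: Erlang_pdf_ge0.
- by rewrite /= /pushforward preimage_setT P1 ltry.
- move=> A mA; rewrite /= /pushforward.
  rewrite (_ : _ @^-1` _ = \bigcap_i (X i @^-1` A i)); last first.
    apply/seteqP; split => w /= wA i.
      by move=> _; have := wA i; rewrite tnth_mktuple.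
    by rewrite tnth_mktuple; exact: wA.
  rewrite Xind//; apply: eq_bigr => i _.
  by rewrite (Xlaw i (A i) (mA i)) (exponential_probE l_gt0 (mA i)).
Qed.

(** The law of the partial sum is the image of the product density under the sum of
    the first coordinates, that is, [integral_Erlang_sum] for an indicator. *)
Lemma partial_sum_law n A : (n < k)%N -> measurable A ->
  P (partial_sum X n.+1 @^-1` A) = \int[mu]_(t in A) (Erlang_pdf n.+1 l t)%:E.
Proof.
move=> nk mA.
pose S (t : k.-tuple RT) : R := (\sum_(i < k | (i < n.+1)%N) (tnth t i : R))%R.
have mS : measurable_fun [set: k.-tuple RT] S by exact: measurable_sum_tnth.
have mSA : measurable (S @^-1` A) by rewrite -[X in measurable X]setTI; exact: mS.
transitivity (P (random_vector X @^-1` (S @^-1` A))).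
  have SE w : S (random_vector X w) = partial_sum X n.+1 w.
    by apply: eq_bigr => i _; rewrite tnth_mktuple.
  by congr (P _); apply/seteqP; split => w; rewrite /preimage/= SE.
rewrite iid_exponential_density// integral_mkcond.
transitivity (\int[lebt (k:=k)]_t
  ((\prod_(i < k) Erlang_pdf 1 l (tnth t i))%:E * (\1_A (S t))%:E)).
  apply: eq_integral => t _; rewrite patchE indicE.
  rewrite (_ : (t \in S @^-1` A) = (S t \in A)); last by apply/idP/idP; rewrite !inE.
  by case: ifP => _; rewrite ?mule1 ?mule0.
rewrite (integral_Erlang_sum (phi := fun s => (\1_A s)%:E))//; last first.
  by apply/measurable_EFinP; exact: measurable_indic.
rewrite [RHS]integral_mkcond; apply: eq_integral => t _; rewrite patchE indicE.
by case: ifP => _; rewrite ?mule1 ?mule0.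
Qed.

End iid_exponential.

Lemma iid_exponential_scale d (T : measurableType d) (R : realType)
    (P : {measure set T -> \bar R}) (k : nat) (X : 'I_k -> T -> R) (l : R) :
    0 < l -> iid P X (exponential_prob 1) ->
  iid P (fun i w => X i w / l) (exponential_prob l).
Proof.
move=> l0 [Xind Xlaw].
have mdiv : measurable_fun [set: R] (fun t : R => t / l) by exact: measurable_funM.
have mdivA A : measurable A -> measurable [set t | A (t / l)].
  by move=> mA; rewrite -[X in measurable X]setTI; exact: mdiv.
split.
  move=> A mA; exact: (Xind (fun i => [set t | A i (t / l)]) (fun i => mdivA _ (mA i))).
move=> i A mA; rewrite exponential_probE// -integral_Erlang_scale//.
rewrite -exponential_probE//; last exact: mdivA.
by apply: Xlaw; exact: mdivA.
Qed.

Section Stacy_law.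
Local Open Scope ereal_scope.
Context d (T : measurableType d) (R : realType) (P : probability T R).
Variables (a b c : R) (xi : {RV P >-> R}).
Hypotheses (xi_Stacy : Stacy P a b c xi).
Local Notation RT := (measurableTypeR R).
Local Notation mu := (@lebesgue_measure R).

Lemma integral_Stacy_pdf1 : \int[mu]_x (Stacy_pdf a b c x)%:E = 1.
Proof.
have [_ [_ _ xiE]] := xi_Stacy; rewrite -(xiE setT)//.
by rewrite preimage_setT probability_setT.
Qed.

Lemma ge0_integral_Stacy (g : R -> \bar R) :
    measurable_fun [set: R] g -> (forall x, 0 <= g x) ->
  \int[P]_w g (xi w) = \int[mu]_x ((Stacy_pdf a b c x)%:E * g x).
Proof.
move=> mg g0; have [_ xid] := xi_Stacy.
apply: (@ge0_integral_law _ _ T RT R P mu _ (xi : T -> RT) g) => //.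
exact: (measurable_funPT xi).
Qed.

End Stacy_law.

Section Stacy_mixture.
Local Open Scope ereal_scope.
Context (R : realType) (a b c : R).
Hypotheses (b_gt0 : (0 < b)%R) (c_neq0 : c != 0%R).
Local Notation RT := (measurableTypeR R).
Local Notation mu := (@lebesgue_measure R).
Local Notation p := (Stacy_pdf a b c).
Hypothesis p1 : \int[mu]_x (p x)%:E = 1.

(** The Stacy density lives on the half line: conditional laws matter for
    positive values of the parameter only. *)
Lemma Stacy_mixture_eq (f g : R -> \bar R) :
  (forall x, (0 < x)%R -> f x = g x) ->
  \int[mu]_x ((p x)%:E * f x) = \int[mu]_x ((p x)%:E * g x).
Proof.
move=> fg; apply: eq_integral => x _; rewrite /Stacy_pdf.
by case: ifP => x0; rewrite ?mul0e// fg.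
Qed.

(** As a function of the rate x, the Erlang density is a multiple of
    x^(n+1) e^(- t x). *)
Lemma Erlang_mixture n t :
  \int[mu]_x (p x * Erlang_pdf n.+1 x t)%:E = (ErlangSt_pdf n.+1 a b c t)%:E.
Proof.
rewrite /ErlangSt_pdf; case: ifP => t0; last first.
  by rewrite integral0_eq// => x _; rewrite /Erlang_pdf t0 andbF mulr0.
transitivity (\int[mu]_x ((t ^+ n / n`!%:R)%:E *
    (p x * (x ^+ n.+1 * expR (- (t * x))))%:E)).
  apply: eq_integral => x _; rewrite -EFinM; congr _%:E.
  rewrite /Erlang_pdf t0 andbT /Stacy_pdf; case: ifP => x0; last by rewrite !mul0r mulr0.
  by rewrite [(x * t)%R]mulrC; ring.
have mx : measurable_fun [set: R]
    (fun x => p x * (x ^+ n.+1 * expR (- (t * x))))%R.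
  apply: measurable_funM; first exact: measurable_Stacy_pdf.
  apply: measurable_funM; first exact: measurable_funX.
  by apply: measurableT_comp => //; apply: measurableT_comp => //; exact: measurable_funM.
have px0 x : (0 <= p x * (x ^+ n.+1 * expR (- (t * x))))%R.
  have [x0|x0] := ltP 0%R x; last by rewrite /Stacy_pdf ltNge x0 mul0r.
  by rewrite mulr_ge0 ?Stacy_pdf_ge0// mulr_ge0 ?expR_ge0 ?exprn_ge0// ltW.
rewrite ge0_integralZl//; last 3 first.
- by apply/measurable_EFinP; exact: mx.
- by move=> x _; rewrite lee_fin.
- by rewrite lee_fin divr_ge0// exprn_ge0// ltW.
rewrite Stacy_Laplace// -EFinM; congr _%:E => /=.
have G0 := fine_Gamma_gt0 b_gt0 p1.
field.
by rewrite !gt_eqF//= exprn_gt0.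
Qed.

Lemma ErlangSt_mixture d (T : measurableType d) (P : probability T R) (Y : T -> R) n :
    (forall A, measurable A -> P (Y @^-1` A) =
      \int[mu]_x ((p x)%:E * \int[mu]_(t in A) (Erlang_pdf n.+1 x t)%:E)) ->
  ErlangSt P n.+1 a b c Y.
Proof.
move=> YE.
apply: (@mixture_has_density _ _ _ RT R Y P mu mu p
  (fun z => Erlang_pdf n.+1 z.1 z.2)) => //.
- exact: measurable_Stacy_pdf.
- by move=> x; exact: Stacy_pdf_ge0.
- exact: measurable_Erlang_pdf2.
- by move=> z; exact: Erlang_pdf_ge0.
- exact: Erlang_mixture.
Qed.

Lemma ExpSt_pdfE t : ExpSt_pdf a b c t = ErlangSt_pdf 1 a b c t.
Proof.
by rewrite /ExpSt_pdf /ErlangSt_pdf; case: ifP => // _; rewrite expr0 fact0 !mul1r expr1.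
Qed.

End Stacy_mixture.

Lemma has_density_scale d (T : measurableType d) (R : realType)
    (P : set T -> \bar R) (Y : T -> R) (f g : R -> R) (r : R) : 0 < r ->
    (forall t, r * g (r * t) = f t) ->
  has_density lebesgue_measure f P Y ->
  has_density lebesgue_measure g P (fun w => r * Y w).
Proof.
move=> r0 fg [mf f0 YE].
have rK t : r * (r^-1 * t) = t by rewrite mulrA divff ?mul1r// gt_eqF.
have gE t : g t = r^-1 * f (r^-1 * t) by rewrite -fg rK mulrA mulVf ?mul1r// gt_eqF.
have mr (s : R) : measurable_fun [set: R] (fun t : R => s * t).
  exact: measurable_funM.
have g0 t : 0 <= g t by rewrite gE mulr_ge0 ?invr_ge0// ltW.
have mg : measurable_fun [set: R] g.
  apply: (eq_measurable_fun (fun t => r^-1 * f (r^-1 * t))) => [t _|]; first by rewrite gE.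
  apply: measurable_funM; first exact: measurable_cst.
  exact: (measurableT_comp mf (mr r^-1)).
split=> // A mA.
have mAr : measurable [set t | A (r * t)].
  by rewrite -[X in measurable X]setTI; exact: mr.
transitivity (P (Y @^-1` [set t | A (r * t)])) => //.
have mgA : measurable_fun [set: R] ((fun t => (g t)%:E) \_ A).
  apply/(measurable_restrictT _ mA) => //; apply: measurable_funTS.
  exact/measurable_EFinP.
have gA0 t : (0 <= ((fun t => (g t)%:E) \_ A) t)%E.
  by rewrite patchE; case: ifP => // _; rewrite lee_fin.
rewrite YE// [LHS]integral_mkcond [RHS]integral_mkcond.
rewrite [RHS](ge0_integral_affine (r := r) 0) ?gt_eqF//.
have mraff : measurable_fun [set: R] (fun t : R => r * t + 0).
  by apply: measurable_funD.
rewrite -ge0_integralZl//; last first.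
  exact: (measurableT_comp mgA mraff).
apply: eq_integral => t _; rewrite !patchE addr0 gtr0_norm// -fg.
rewrite (_ : (t \in [set t | A (r * t)]) = ((r * t) \in A)); last first.
  by apply/idP/idP; rewrite !inE.
by case: ifP => _; rewrite ?mule0// EFinM.
Qed.

Section Stacy_mixture_laws.
Local Open Scope ereal_scope.
Context (R : realType) (a b c : R).
Hypotheses (b_gt0 : (0 < b)%R) (c_neq0 : c != 0%R).
Local Notation RT := (measurableTypeR R).
Local Notation mu := (@lebesgue_measure R).
Local Notation p := (Stacy_pdf a b c).
Hypothesis p1 : \int[mu]_x (p x)%:E = 1.

Lemma prod_Erlang_pdf1 k x (t : k.-tuple R) : (0 < x)%R ->
  (\prod_(i < k) Erlang_pdf 1 x (tnth t i) =
   if [forall i, (0 < tnth t i)%R]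
   then x ^+ k * expR (- ((\sum_(i < k) tnth t i) * x)) else 0)%R.
Proof.
move=> x0; case: ifPn => [/forallP t0|].
  rewrite mulr_suml -sumrN expR_sum.
  have -> : (x ^+ k = \prod_(i < k) x)%R by rewrite prodr_const card_ord.
  rewrite -big_split/=.
  apply: eq_bigr => i _; rewrite /Erlang_pdf x0 t0/= expr1 expr0 fact0 divr1 mulr1.
  by rewrite mulrC [(x * _)%R]mulrC mulrC.
rewrite negb_forall => /existsP[i ti]; rewrite (bigD1 i)//=.
by rewrite /Erlang_pdf (negbTE ti) andbF mul0r.
Qed.

Lemma measurable_prod_Erlang_pdf1 k : measurable_fun [set: R * k.-tuple RT]
  (fun z => \prod_(i < k) Erlang_pdf 1 z.1 (tnth z.2 i))%R.
Proof.
apply: measurable_prod => i _.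
have mti : measurable_fun [set: R * k.-tuple RT] (fun z => (z.1, tnth z.2 i : R)).
  apply: measurable_fun_pair => //.
  exact: (measurableT_comp (@measurable_tnth _ RT k i) measurable_snd).
exact: (measurableT_comp (measurable_Erlang_pdf2 1) mti).
Qed.

(** The product density depends on t through the sum of its entries alone, which is
    the Laplace variable.  The sum is positive since k > 0. *)
Lemma ExpStacyII_mixture d (T : measurableType d) (P : probability T R) k
    (X : 'I_k -> T -> R) : (0 < k)%N ->
    (forall B : set (k.-tuple RT), measurable B ->
      P (random_vector X @^-1` B) =
      \int[mu]_x ((p x)%:E * \int[lebt (k:=k)]_(t in B)
        (\prod_(i < k) Erlang_pdf 1 x (tnth t i))%:E)) ->
  ExpStacyII P a b c X.
Proof.
move=> k0 XE.
apply: (@mixture_has_density _ _ _ (k.-tuple RT) R _ P mu (lebt (k:=k)) p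
  (fun z => \prod_(i < k) Erlang_pdf 1 z.1 (tnth z.2 i))%R) => //.
- exact: measurable_Stacy_pdf.
- by move=> x; exact: Stacy_pdf_ge0.
- exact: measurable_prod_Erlang_pdf1.
- by move=> z; apply: prodr_ge0 => i _; exact: Erlang_pdf_ge0.
move=> t /=; rewrite /ExpStacyII_pdf.
transitivity (\int[mu]_x (p x * if [forall i, (0 < tnth t i)%R] then
  x ^+ k * expR (- ((\sum_(i < k) tnth t i) * x)) else 0)%:E).
  apply: eq_integral => x _; rewrite /Stacy_pdf; case: ifP => x0; last by rewrite !mul0r.
  by rewrite prod_Erlang_pdf1.
case: ifPn => [/forallP t0|_]; last by rewrite integral0_eq// => x _; rewrite mulr0.
rewrite Stacy_Laplace//.
rewrite (bigD1 (Ordinal k0))//= ltr_pwDl//.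
by apply: sumr_ge0 => i _; exact: ltW.
Qed.

(** The absolute value makes the integrand nonnegative everywhere, as Tonelli's
    theorem requires; the density vanishes where it differs from t. *)
Lemma ErlangSt_moment n m :
  \int[mu]_t ((ErlangSt_pdf n.+1 a b c t)%:E * (`|t| ^+ m)%:E) =
  ((n + m)`!%:R / n`!%:R * b ^+ m / fine (Gamma a))%:E * Gamma (a - m%:R / c).
Proof.
pose h (z : RT * RT) := (p z.1 * Erlang_pdf n.+1 z.1 z.2)%:E * (`|z.2 : R| ^+ m)%:E.
have mabs : measurable_fun [set: R] (fun t : R => (`|t| ^+ m)%:E).
  by apply/measurable_EFinP; apply: measurable_funX; exact: normr_measurable.
have mh : measurable_fun [set: RT * RT] h.
  apply: emeasurable_funM; last exact: (measurableT_comp mabs measurable_snd).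
  apply/measurable_EFinP; apply: measurable_funM.
    exact: (measurableT_comp (measurable_Stacy_pdf a b c) measurable_fst).
  exact: measurable_Erlang_pdf2.
have h0 z : 0 <= h z.
  by rewrite mule_ge0 ?lee_fin// mulr_ge0 ?Stacy_pdf_ge0 ?Erlang_pdf_ge0.
have mE x : measurable_fun [set: R] (fun t => (Erlang_pdf n.+1 x t)%:E).
  by apply/measurable_EFinP; exact: measurable_Erlang_pdf.
transitivity (\int[mu]_t \int[mu]_x h (x, t)).
  apply: eq_integral => t _; rewrite -Erlang_mixture// -ge0_integralZr//.
  - apply/measurable_EFinP; apply: measurable_funM; first exact: measurable_Stacy_pdf.
    exact: (measurableT_comp (measurable_Erlang_pdf2 n.+1) (measurable_pair2 t)).
  - by move=> x _; rewrite lee_fin mulr_ge0 ?Stacy_pdf_ge0 ?Erlang_pdf_ge0.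
rewrite -(fubini_tonelli h)//.
transitivity (\int[mu]_x (((n + m)`!%:R / n`!%:R)%:E * (p x * x ^- m)%:E)).
  apply: eq_integral => x _.
  transitivity ((p x)%:E * \int[mu]_t ((t ^+ m)%:E * (Erlang_pdf n.+1 x t)%:E)).
    rewrite -ge0_integralZl ?lee_fin ?Stacy_pdf_ge0//.
    - apply: eq_integral => t _; rewrite /h/= -!EFinM; congr _%:E.
      rewrite /Erlang_pdf; case: ifPn => [/andP[_ t0]|_]; last by rewrite !(mulr0, mul0r).
      by rewrite gtr0_norm//; ring.
    - apply: emeasurable_funM; last exact: mE.
      by apply/measurable_EFinP; exact: measurable_funX.
    - move=> t _; rewrite -EFinM lee_fin /Erlang_pdf.
      case: ifPn => [/andP[x0 t0]|_]; last by rewrite mulr0.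
      by rewrite !mulr_ge0 ?expR_ge0 ?exprn_ge0 ?invr_ge0 ?ler0n ?ltW.
  have [x0|x0] := ltP 0%R x; last by rewrite /Stacy_pdf ltNge x0/= mul0e mul0r mule0.
  by rewrite integral_Erlang_moment// -!EFinM; congr _%:E; ring.
rewrite ge0_integralZl//; last 2 first.
- apply/measurable_EFinP; apply: (eq_measurable_fun (fun x : R => p x * x `^ (- m%:R))%R).
    move=> x _; rewrite /Stacy_pdf; case: ifP => x0; last by rewrite !mul0r.
    by rewrite powRN powR_mulrn// ltW.
  apply: measurable_funM; first exact: measurable_Stacy_pdf.
  exact: measurable_powR.
- move=> x _; rewrite lee_fin /Stacy_pdf; case: ifP => x0; last by rewrite mul0r.
  have := Stacy_pdf_ge0 a b c x; rewrite /Stacy_pdf x0 => px.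
  by rewrite mulr_ge0// invr_ge0 exprn_ge0// ltW.
by rewrite Stacy_neg_moment// muleA -EFinM; congr (_%:E * _); ring.
Qed.

Lemma ErlangSt_pdf_scale n r t : (0 < r)%R ->
  (r * ErlangSt_pdf n.+1 a (r * b) c (r * t) = ErlangSt_pdf n.+1 a b c t)%R.
Proof.
move=> r0; rewrite /ErlangSt_pdf (pmulr_rgt0 _ r0); case: ifP => _; last by rewrite mulr0.
have -> : ((r * t) / (r * b) = t / b)%R by field; rewrite !gt_eqF.
have G0 := fine_Gamma_gt0 b_gt0 p1.
rewrite !exprMn !exprS/=; field.
by rewrite !gt_eqF//= ?exprn_gt0// ltr0n fact_gt0.
Qed.

Lemma ErlangSt_scale d (T : measurableType d) (P : probability T R) (Y : T -> R) n r :
  (0 < r)%R -> ErlangSt P n.+1 a b c Y ->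
  ErlangSt P n.+1 a (r * b) c (fun w => r * Y w)%R.
Proof.
move=> r0 Yd; apply: (has_density_scale r0 _ Yd) => t.
exact: ErlangSt_pdf_scale.
Qed.

End Stacy_mixture_laws.

(** * Mean and variance *)

Section positive_density_moments.
Local Open Scope ereal_scope.
Context d (T : measurableType d) (R : realType) (P : probability T R).
Variables (Y : T -> R) (f : R -> R).
Local Notation RT := (measurableTypeR R).
Local Notation mu := (@lebesgue_measure R).
Hypotheses (mY : measurable_fun [set: T] Y)
  (Yf : has_density mu f P Y) (f_pos : forall t, (t <= 0)%R -> f t = 0%R).

Let mf : measurable_fun [set: R] f. Proof. by case: Yf. Qed.
Let f0 t : (0 <= f t)%R. Proof. by case: Yf => _ /(_ t). Qed.

Let ge0_integral_Y (g : R -> \bar R) :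
    measurable_fun [set: R] g -> (forall t, 0 <= g t) ->
  \int[P]_w g (Y w) = \int[mu]_t ((f t)%:E * g t).
Proof. exact: (@ge0_integral_law _ _ T RT R P mu f (Y : T -> RT) g mY Yf). Qed.

Let eq_integral_pos (g h : R -> \bar R) :
    (forall t, (0 < t)%R -> g t = h t) ->
  \int[mu]_t ((f t)%:E * g t) = \int[mu]_t ((f t)%:E * h t).
Proof.
move=> gh; apply: eq_integral => t _.
have [t0|t0] := ltP 0%R t; first by rewrite gh.
by rewrite f_pos// !mul0e.
Qed.

(** Y may take negative values on a null set.  The positive and negative parts are
    functions of Y, so that both are integrated through the density. *)
Lemma positive_density_expectation :
  'E_P[Y] = \int[mu]_t ((f t)%:E * (`|t| ^+ 1)%:E).
Proof.
pose gp (t : R) := maxe t%:E 0; pose gm (t : R) := maxe (- t%:E) 0.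
have mE : measurable_fun [set: R] (EFin : R -> \bar R) by exact/measurable_EFinP.
have mgp : measurable_fun [set: R] gp by apply: measurable_maxe => //; exact: measurable_cst.
have mgm : measurable_fun [set: R] gm
  by apply: measurable_maxe; [exact: measurableT_comp|exact: measurable_cst].
transitivity (\int[P]_w gp (Y w) - \int[P]_w gm (Y w)).
  by rewrite unlock integralE; congr (_ - _); apply: eq_integral => w _;
    rewrite ?funeposE ?funenegE.
rewrite !ge0_integral_Y//; last 2 first.
- by move=> t; rewrite /gm le_max lexx orbT.
- by move=> t; rewrite /gp le_max lexx orbT.
rewrite [X in _ - X](eq_integral_pos (h := cst 0)); last first.
  by move=> t t0; rewrite /gm max_r// lee_fin oppr_le0 ltW.
rewrite [X in _ - X]integral0_eq; last by move=> t _; rewrite mule0.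
rewrite sube0; apply: eq_integral_pos => t t0.
by rewrite /gp max_l ?lee_fin ?ltW// expr1 gtr0_norm.
Qed.

(** Only the mean m is assumed finite.  To avoid subtracting infinities, integrate
    (t - m)^2 + 2 m t = t^2 + m^2, whose terms are all nonnegative on the
    support of f. *)
Lemma positive_density_variance (m : R) :
    \int[mu]_t ((f t)%:E * (`|t| ^+ 1)%:E) = m%:E ->
  'V_P[Y] = \int[mu]_t ((f t)%:E * (`|t| ^+ 2)%:E) - (m ^+ 2)%:E.
Proof.
move=> mE.
have mabs k : measurable_fun [set: R] (fun t : R => (f t)%:E * (`|t| ^+ k)%:E).
  apply/measurable_EFinP; apply: measurable_funM => //.
  by apply: measurable_funX; exact: normr_measurable.
have abs0 k (t : R) : 0 <= (f t)%:E * (`|t| ^+ k)%:E by rewrite mule_ge0 ?lee_fin.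
have m0 : (0 <= m)%R by rewrite -lee_fin -mE; exact: integral_ge0.
have msq : measurable_fun [set: R] (fun t : R => ((t - m) ^+ 2)%:E).
  by apply/measurable_EFinP; apply: measurable_funX; exact: measurable_funB.
have sq0 (t : R) : 0 <= ((t - m) ^+ 2)%:E by rewrite lee_fin sqr_ge0.
have mfsq : measurable_fun [set: R] (fun t : R => (f t)%:E * ((t - m) ^+ 2)%:E).
  by apply: emeasurable_funM => //; exact/measurable_EFinP.
have fsq0 (t : R) : 0 <= (f t)%:E * ((t - m) ^+ 2)%:E.
  by apply: mule_ge0 => //; rewrite lee_fin.
have f1 : \int[mu]_t (f t)%:E = 1.
  have [_ _ YE] := Yf; rewrite -(YE setT)//.
  by rewrite preimage_setT probability_setT.
have -> : 'V_P[Y] = \int[mu]_t ((f t)%:E * ((t - m) ^+ 2)%:E).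
  rewrite /variance covariance.unlock positive_density_expectation mE unlock /=.
  by rewrite -ge0_integral_Y.
have key : \int[mu]_t ((f t)%:E * ((t - m) ^+ 2)%:E) + (2 * m)%:E * m%:E =
    \int[mu]_t ((f t)%:E * (`|t| ^+ 2)%:E) + (m ^+ 2)%:E.
  have m2 : 0 <= (2 * m)%:E by rewrite lee_fin mulr_ge0.
  have msq2 : 0 <= (m ^+ 2)%:E by rewrite lee_fin sqr_ge0.
  have mf' : measurable_fun [set: R] (fun t : R => (f t)%:E) by exact/measurable_EFinP.
  have f0' (t : R) : 0 <= (f t)%:E by rewrite lee_fin.
  rewrite -mE -[X in _ = _ + X]mule1 -f1.
  rewrite -!(ge0_integralZl _ _ _ _)//.
  rewrite -!ge0_integralD//.
  - apply: eq_integral => t _; rewrite -!EFinM -!EFinD; congr _%:E.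
    have [t0|t0] := ltP 0%R t; last by rewrite f_pos// !(mul0r, mulr0).
    by rewrite gtr0_norm//; ring.
  all: try by move=> t _; rewrite mule_ge0.
  all: try by apply: emeasurable_funM; [exact: measurable_cst|exact: (mabs 1%N)].
  all: try by apply: emeasurable_funM; [exact: measurable_cst|exact: mf'].
  all: try exact: (mabs 1%N).
  all: try exact: (mabs 2%N).
move: key; rewrite -EFinM.
case: (\int[mu]_t ((f t)%:E * ((t - m) ^+ 2)%:E)) => [v||];
  case: (\int[mu]_t ((f t)%:E * (`|t| ^+ 2)%:E)) => [s||]//=.
by rewrite -!EFinD => -[key]; congr _%:E; lra.
Qed.

End positive_density_moments.

Section ErlangSt_mean_variance.
Local Open Scope ereal_scope.
Context (R : realType) (a b c : R).
Hypotheses (a_gt0 : (0 < a)%R) (b_gt0 : (0 < b)%R) (c_neq0 : c != 0%R).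
Local Notation mu := (@lebesgue_measure R).
Hypothesis p1 : \int[mu]_x (Stacy_pdf a b c x)%:E = 1.
Context d (T : measurableType d) (P : probability T R) (Y : T -> R) (n : nat).
Hypotheses (mY : measurable_fun [set: T] Y) (Y_ErlangSt : ErlangSt P n.+1 a b c Y).

Let ErlangSt_pdf_pos t : (t <= 0)%R -> ErlangSt_pdf n.+1 a b c t = 0%R.
Proof. by move=> t0; rewrite /ErlangSt_pdf ltNge t0. Qed.

Lemma ErlangSt_expectation :
  'E_P[Y] = (n.+1%:R * b / fine (Gamma a))%:E * Gamma (a - c^-1).
Proof.
rewrite (positive_density_expectation mY Y_ErlangSt ErlangSt_pdf_pos).
rewrite ErlangSt_moment// addn1 expr1 mul1r factS natrM; congr (_%:E * _).
by rewrite mulfK// pnatr_eq0 -lt0n fact_gt0.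
Qed.

(** The hypothesis makes a - 1/c positive, hence the mean finite.  At a = 2/c the
    second moment is infinite, and both sides are too. *)
Lemma ErlangSt_variance : (Num.max c^-1 (2 / c) <= a)%R ->
  'V_P[Y] = (n.+1%:R * b ^+ 2 / fine (Gamma a))%:E *
    (n.+2%:R%:E * Gamma (a - 2 / c) -
     (n.+1%:R / fine (Gamma a))%:E * Gamma (a - c^-1) ^+ 2).
Proof.
rewrite ge_max => /andP[ca c2a].
have G0 := fine_Gamma_gt0 b_gt0 p1.
have ac : (0 < a - c^-1)%R.
  rewrite subr_gt0; have [c0|c0] := ltP 0%R c^-1%R; last exact: le_lt_trans a_gt0.
  by apply: lt_le_trans c2a; rewrite mulr_natl mulr2n ltrDl.
have Gfin : Gamma (a - c^-1) \is a fin_num.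
  by rewrite ge0_fin_numE; [exact: Gamma_lt_pinfty|exact: Gamma_ge0].
rewrite (positive_density_variance mY Y_ErlangSt ErlangSt_pdf_pos
  (m := (n.+1%:R * b / fine (Gamma a) * fine (Gamma (a - c^-1)))%R)); last first.
  rewrite -(positive_density_expectation mY Y_ErlangSt ErlangSt_pdf_pos).
  by rewrite ErlangSt_expectation -{1}(fineK Gfin) -EFinM.
rewrite ErlangSt_moment// addn2 !factS.
rewrite -(fineK Gfin) -EFin_expe -EFinM.
have := Gamma_ge0 (a - 2 / c)%R; case: (Gamma (a - 2 / c)%R) => [g _||]//=.
- apply: (congr1 EFin).
  rewrite !natrM; field.
  by rewrite !gt_eqF// ltr0n fact_gt0.
- move=> _; rewrite !gt0_muley ?lte_fin ?ltr0n//=.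
  all: by rewrite !mulr_gt0 ?invr_gt0 ?exprn_gt0 ?ltr0n ?muln_gt0 ?fact_gt0.
Qed.

End ErlangSt_mean_variance.

(** * Ratios by an independent Stacy variable *)

(** Gamma (n + 1) is n!, read off the total mass of the Erlang density. *)
Lemma Gamma_n1_Erlang d (T : measurableType d) (R : realType) (P : probability T R)
    (theta : T -> R) n : Gamma_n1 P n.+1 theta ->
  forall A, measurable A ->
  P (theta @^-1` A) = (\int[lebesgue_measure]_(t in A) (Erlang_pdf n.+1 1 t)%:E)%E.
Proof.
move=> [_ _ thetaE] A mA; rewrite thetaE//; apply: eq_integral => t _; congr _%:E.
suff GE : fine (Gamma (n.+1%:R : R)) = n`!%:R.
  rewrite /Gamma_pdf /Erlang_pdf ltr01/=; case: ifP => // t0.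
  by rewrite GE expr1n mul1r mul1r [X in X * _]mulrC.
have -> // : Gamma (n.+1%:R : R) = (n`!%:R)%:E.
rewrite -[RHS]mule1 -(@integral_Erlang_pdf R n 1)// -ge0_integralZl//.
- rewrite /Gamma [LHS]integral_mkcond; congr integral; apply/funext => y.
  rewrite patchE mem_setE in_itv/= andbT /Erlang_pdf ltr01/=.
  case: ifP => y0; last by rewrite mule0.
  have -> : n.+1%:R - 1 = n%:R :> R by rewrite -natr1 addrK.
  rewrite -EFinM; congr _%:E; rewrite powR_mulrn ?ltW//.
  rewrite expr1n mul1r mul1r; field.
  by rewrite pnatr_eq0 -lt0n fact_gt0.
- by apply/measurable_EFinP; exact: measurable_Erlang_pdf.
- by move=> y _; rewrite lee_fin Erlang_pdf_ge0.
Qed.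

Section ratio.
Local Open Scope ereal_scope.
Context (R : realType) (a b c : R).
Local Notation RT := (measurableTypeR R).
Local Notation mu := (@lebesgue_measure R).
Local Notation p := (Stacy_pdf a b c).
Context d (T : measurableType d) (P : probability T R) (xi : {RV P >-> R}).
Hypothesis xi_Stacy : Stacy P a b c xi.

Lemma Stacy_disintegration d1 (S : measurableType d1) (Z : {mfun T >-> S})
    (C : set (S * R)) : independent P Z xi -> measurable C ->
  P [set w | C (Z w, xi w)] = \int[mu]_y ((p y)%:E * P [set v | C (Z v, y)]).
Proof.
move=> Zxi mC; rewrite (independent_disintegration Zxi mC).
have PE y : P [set v | C (Z v, y)] = (distribution P Z \o ysection C) y.
  rewrite /= /distribution /pushforward; congr (P _).
  by apply/seteqP; split => v /=; rewrite ysectionE.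
rewrite (ge0_integral_Stacy xi_Stacy (g := fun y => P [set v | C (Z v, y)]))//.
rewrite (_ : (fun y => _) = distribution P Z \o ysection C).
  exact: measurable_fun_ysection.
by apply/funext.
Qed.

Lemma measurable_ratio d1 (S : measurableType d1) (s : S -> R) :
  measurable_fun [set: S] s ->
  measurable_fun [set: S * R] (fun z : S * R => s z.1 / z.2)%R.
Proof.
move=> ms; apply: measurable_funM; first exact: (measurableT_comp ms measurable_fst).
exact: (measurableT_comp (@measurable_invr R) measurable_snd).
Qed.

(** Conditioning on xi = y replaces Z / xi by Z / y, which is Erlang with rate y. *)
Lemma ratio_law (Z : T -> R) n (A : set R) : measurable_fun [set: T] Z ->
    independent P Z xi -> measurable A ->
    (forall B, measurable B ->
      P (Z @^-1` B) = \int[mu]_(t in B) (Erlang_pdf n.+1 1 t)%:E) ->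
  P [set w | A (Z w / xi w)%R] =
  \int[mu]_y ((p y)%:E * \int[mu]_(t in A) (Erlang_pdf n.+1 y t)%:E).
Proof.
move=> mZ Zxi mA ZE.
pose Zm : {mfun T >-> R} := HB.pack Z (isMeasurableFun.Build _ _ _ _ _ mZ).
have mdiv : measurable_fun [set: R * R] (fun z : R * R => z.1 / z.2)%R.
  exact: (measurable_ratio (@measurable_id _ R setT)).
have mC : measurable [set z : R * R | A (z.1 / z.2)%R].
  by rewrite -[X in measurable X]setTI; exact: mdiv.
rewrite (Stacy_disintegration (Z := Zm) Zxi mC) /=.
apply: Stacy_mixture_eq => y y0.
rewrite -integral_Erlang_scale//; apply: ZE.
have my : measurable_fun [set: R] (fun t : R => t / y)%R by exact: measurable_funM.
by rewrite -[X in measurable X]setTI; exact: my.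
Qed.

(** Conditioning on xi = y leaves the variables eta i / y, which are independent
    and exponential with rate y. *)
Lemma ratio_vector_law k (eta : 'I_k -> {RV P >-> R}) (B : set (k.-tuple RT)) :
    iid P (fun i => eta i : T -> R) (exponential_prob 1) ->
    independent P (random_vector eta : T -> k.-tuple R) xi -> measurable B ->
  P [set w | B (random_vector (fun i w => eta i w / xi w)%R w)] =
  \int[mu]_y ((p y)%:E * \int[lebt (k:=k)]_(t in B)
    (\prod_(i < k) Erlang_pdf 1 y (tnth t i))%:E).
Proof.
move=> eta_iid eta_xi mB.
have meta i : measurable_fun [set: T] (eta i : T -> R) by exact: measurable_funPT.
have mv : measurable_fun [set: T] (random_vector eta : T -> k.-tuple R).
  exact: (measurable_random_vector meta).
pose Z : {mfun T >-> k.-tuple R} := HB.pack (random_vector eta : T -> k.-tuple R)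
  (isMeasurableFun.Build _ _ _ _ _ mv).
pose q (z : k.-tuple R * R) : k.-tuple R := [tuple (tnth z.1 i / z.2)%R | i < k].
have mq : measurable_fun [set: k.-tuple R * R] q.
  apply/measurable_fun_tnthP => i.
  apply: (eq_measurable_fun (fun z : k.-tuple R * R => tnth z.1 i / z.2)%R).
    by move=> z _ /=; rewrite tnth_mktuple.
  exact: (measurable_ratio (@measurable_tnth _ R k i)).
have mC : measurable (q @^-1` B) by rewrite -[X in measurable X]setTI; exact: mq.
have qE w y : q (random_vector eta w, y) = random_vector (fun i w => eta i w / y)%R w.
  by apply: eq_from_tnth => i; rewrite !tnth_mktuple.
transitivity (P [set w | (q @^-1` B) (Z w, xi w)]).
  congr (P _); apply/funext => w /=.
  exact: (congr1 B (esym (qE w (xi w)))).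
rewrite (Stacy_disintegration (Z := Z) eta_xi mC).
apply: Stacy_mixture_eq => y y0.
rewrite -(iid_exponential_density (P := P) (X := fun i w => (eta i w / y)%R))//.
- by congr (P _); apply/seteqP; split => w /=; rewrite -qE.
- exact: probability_setT.
- by move=> i; exact: measurable_funM.
- exact: iid_exponential_scale.
Qed.

End ratio.

Lemma sum_ratio_law (R : realType) d (T : measurableType d) (P : probability T R)
    (a b c : R) (xi : {RV P >-> R}) n (eta : 'I_n.+1 -> {RV P >-> R}) (A : set R) :
    Stacy P a b c xi -> iid P (fun i => eta i : T -> R) (exponential_prob 1) ->
    independent P (random_vector eta : T -> n.+1.-tuple R) xi -> measurable A ->
  P [set w | A ((\sum_(i < n.+1) eta i w) / xi w)] =
  (\int[lebesgue_measure]_y ((Stacy_pdf a b c y)%:E *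
    \int[lebesgue_measure]_(t in A) (Erlang_pdf n.+1 y t)%:E))%E.
Proof.
move=> xi_Stacy eta_iid eta_xi mA.
have meta i : measurable_fun [set: T] (eta i : T -> R) by exact: measurable_funPT.
have mS : measurable_fun [set: T] (fun w => \sum_(i < n.+1) eta i w).
  exact: measurable_sum.
apply: (ratio_law xi_Stacy mS) => // [A' B mA' mB|B mB].
  pose S (t : n.+1.-tuple R) := \sum_(i < n.+1) tnth t i.
  have mSt : measurable_fun [set: n.+1.-tuple R] S.
    by apply: measurable_sum => i; exact: measurable_tnth.
  have SE : (fun w => \sum_(i < n.+1) eta i w) = S \o random_vector eta.
    by apply/funext => w; apply: eq_bigr => i _; rewrite tnth_mktuple.
  rewrite SE comp_preimage; apply: eta_xi => //.
  by rewrite -[X in measurable X]setTI; exact: mSt.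
rewrite -(partial_sum_law (P := P) (X := fun i => eta i : T -> R) (k := n.+1))//.
  congr (P _); apply/funext => w; rewrite /preimage/=; congr (B _).
  by rewrite /partial_sum; apply: eq_bigl => i; rewrite ltn_ord.
exact: probability_setT.
Qed.

(** * The conditionally exponential vector *)

Section conditional_law.
Local Open Scope ereal_scope.
Context (R : realType) d (T : measurableType d) (P : probability T R)
  (a b c : R) (k : nat) (xi : {RV P >-> R}) (tau : 'I_k -> {RV P >-> R})
  (kappa : R.-pker R ~> (k.-tuple R)).
Hypotheses (xi_Stacy : Stacy P a b c xi)
  (kappa_law : regular_conditional_law xi (random_vector tau) kappa)
  (kappa_iid : forall lambda : R, (0 < lambda)%R ->
      iid (kappa lambda) (fun (i : 'I_k) (t : k.-tuple R) => tnth t i)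
        (exponential_prob lambda)).
Local Notation mu := (@lebesgue_measure R).
Local Notation p := (Stacy_pdf a b c).

(** The conditional law enters the law of tau only through its values at positive
    parameters, where the hypothesis on [kappa] describes it. *)
Lemma conditional_mixture (B : set (k.-tuple R)) (F : R -> \bar R) : measurable B ->
    (forall x, (0 < x)%R -> kappa x B = F x) ->
  P (random_vector tau @^-1` B) = \int[mu]_x ((p x)%:E * F x).
Proof.
move=> mB kappaF; rewrite -(Stacy_mixture_eq _ _ _ kappaF).
have := kappa_law measurableT mB; rewrite preimage_setT setTI => ->.
rewrite ge0_integral_distribution//; last exact: measurable_kernel.
by rewrite -(ge0_integral_Stacy xi_Stacy)//; exact: measurable_kernel.
Qed.

Let tnth_vector (t : k.-tuple R) :
  random_vector (fun (i : 'I_k) (t : k.-tuple R) => tnth t i) t = t.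
Proof. by apply: eq_from_tnth => i; rewrite tnth_mktuple. Qed.

Let mtnth (i : 'I_k) : measurable_fun [set: k.-tuple R] (fun t : k.-tuple R => tnth t i).
Proof. exact: measurable_tnth. Qed.

Let kappa1 x : kappa x setT = 1.
Proof. exact: prob_kernel. Qed.

Lemma conditional_vector_law (B : set (k.-tuple (measurableTypeR R))) : measurable B ->
  P (random_vector tau @^-1` B) =
  \int[mu]_x ((p x)%:E * \int[lebt (k:=k)]_(t in B)
    (\prod_(i < k) Erlang_pdf 1 x (tnth t i))%:E).
Proof.
move=> mB; apply: conditional_mixture => // x x0.
rewrite -(iid_exponential_density (kappa1 x) mtnth x0 (kappa_iid x0) mB).
by congr (kappa x _); apply/funext => t; rewrite /preimage/= tnth_vector.
Qed.

Lemma conditional_coordinate_law i (A : set R) : measurable A ->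
  P (tau i @^-1` A) =
  \int[mu]_x ((p x)%:E * \int[mu]_(t in A) (Erlang_pdf 1 x t)%:E).
Proof.
move=> mA; rewrite -(conditional_mixture (B := (fun t : k.-tuple R => tnth t i) @^-1` A)).
- by congr (P _); apply/funext => w; rewrite /preimage/= tnth_mktuple.
- by rewrite -[X in measurable X]setTI; exact: mtnth.
- move=> x x0; have [_ tlaw] := kappa_iid x0.
  by rewrite (tlaw i A mA) exponential_probE.
Qed.

Lemma conditional_sum_law n (A : set R) : (n < k)%N -> measurable A ->
  P (partial_sum tau n.+1 @^-1` A) =
  \int[mu]_x ((p x)%:E * \int[mu]_(t in A) (Erlang_pdf n.+1 x t)%:E).
Proof.
move=> nk mA.
pose S (t : k.-tuple R) := partial_sum (fun (i : 'I_k) (t : k.-tuple R) => tnth t i) n.+1 t.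
have mS : measurable_fun [set: k.-tuple R] S by exact: measurable_sum_tnth.
rewrite -(conditional_mixture (B := S @^-1` A)).
- congr (P _); apply/funext => w; rewrite /preimage/=; congr (A _).
  by apply: eq_bigr => i _; rewrite tnth_mktuple.
- by rewrite -[X in measurable X]setTI; exact: mS.
- by move=> x x0; exact: (partial_sum_law (kappa1 x) mtnth x0 (kappa_iid x0)).
Qed.

End conditional_law.

Theorem theorem2 (R : realType) (d : measure_display) (T : measurableType d)
    (P : probability T R) (a b c : R) (k : nat)
    (a_gt0 : 0 < a) (b_gt0 : 0 < b) (c_neq0 : c != 0) (k_gt0 : (0 < k)%N)
    (xi : {RV P >-> R}) (tau : 'I_k -> {RV P >-> R})
    (xi_Stacy : Stacy P a b c xi)
    (kappa : R.-pker R ~> (k.-tuple R))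
    (kappa_law : regular_conditional_law xi (random_vector tau) kappa)
    (kappa_iid : forall lambda : R, 0 < lambda ->
      iid (kappa lambda) (fun (i : 'I_k) (t : k.-tuple R) => tnth t i)
        (exponential_prob lambda)) :
  [/\ (* (a) *)
      ExpStacyII P a b c tau,
      (* (b) *)
      forall i : 'I_k, ExpSt P a b c (tau i),
      (* (c) *)
      forall (d' : measure_display) (T' : measurableType d')
        (P' : probability T' R) (xi' : {RV P' >-> R})
        (eta : 'I_k -> {RV P' >-> R}),
        Stacy P' a b c xi' ->
        iid P' (fun i => eta i : T' -> R) (exponential_prob 1) ->
        independent P' (random_vector eta) xi' ->
        eq_in_law P (random_vector tau)
          P' (random_vector (fun i w => eta i w / xi' w)) &
      forall n : nat, (1 <= n <= k)%N ->
      [/\ (* (d) *)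
          [/\ ErlangSt P n a b c (partial_sum tau n),
              c^-1 <= a ->
              ('E_P[partial_sum tau n]
                = (n%:R * b / fine (Gamma a))%:E * Gamma (a - c^-1))%E &
              Num.max c^-1 (2 / c) <= a ->
              ('V_P[partial_sum tau n]
                = (n%:R * b ^+ 2 / fine (Gamma a))%:E
                    * (n.+1%:R%:E * Gamma (a - 2 / c)
                       - (n%:R / fine (Gamma a))%:E
                         * Gamma (a - c^-1) ^+ 2))%E],
          (* (e) *)
          forall (d' : measure_display) (T' : measurableType d')
            (P' : probability T' R) (xi' : {RV P' >-> R})
            (eta : 'I_n -> {RV P' >-> R}),
            Stacy P' a b c xi' ->
            iid P' (fun i => eta i : T' -> R) (exponential_prob 1) ->
            independent P' (random_vector eta) xi' ->
            eq_in_law P (partial_sum tau n) P' (fun w => (\sum_(i < n) eta i w) / xi' w),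
          (* (f) *)
          forall (d' : measure_display) (T' : measurableType d')
            (P' : probability T' R) (xi' theta : {RV P' >-> R}),
            Stacy P' a b c xi' ->
            Gamma_n1 P' n theta ->
            independent P' theta xi' ->
            eq_in_law P (partial_sum tau n) P' (fun w => theta w / xi' w) &
          (* (g) *)
          forall r : R, 0 < r -> ErlangSt P n a (r * b) c (fun w => r * partial_sum tau n w)]].

Proof.
have p1 := integral_Stacy_pdf1 xi_Stacy.
have mtau i : measurable_fun [set: T] (tau i : T -> R) by exact: measurable_funPT.
split.
- apply: ExpStacyII_mixture => // B mB.
  exact: (conditional_vector_law xi_Stacy kappa_law kappa_iid mB).
- move=> i; rewrite /ExpSt.
  have -> : ExpSt_pdf a b c = ErlangSt_pdf 1 a b c by apply/funext => t; exact: ExpSt_pdfE.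
  apply: (ErlangSt_mixture b_gt0 c_neq0 p1) => A mA.
  exact: (conditional_coordinate_law xi_Stacy kappa_law kappa_iid i mA).
- move=> d' T' P' xi' eta xi'_Stacy eta_iid eta_xi' B mB.
  rewrite (conditional_vector_law xi_Stacy kappa_law kappa_iid mB).
  exact/esym/(ratio_vector_law xi'_Stacy eta_iid eta_xi' mB).
move=> [//|n] /= nk.
have sumE := fun A => @conditional_sum_law R d T P a b c k xi tau kappa
  xi_Stacy kappa_law kappa_iid n A nk.
have ErlST : ErlangSt P n.+1 a b c (partial_sum tau n.+1).
  exact: (ErlangSt_mixture b_gt0 c_neq0 p1 sumE).
have mS : measurable_fun [set: T] (partial_sum tau n.+1).
  apply: (eq_measurable_fun (fun w : T =>
      \sum_(i < k | (i < n.+1)%N) (tnth (random_vector tau w) i : R))).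
    by move=> w _; apply: eq_bigr => i _; rewrite tnth_mktuple.
  exact: (measurableT_comp (@measurable_sum_tnth R k n.+1)
    (measurable_random_vector mtau)).
split.
- split => //.
  + by move=> _; exact: (ErlangSt_expectation b_gt0 c_neq0 p1 mS ErlST).
  + exact: (ErlangSt_variance a_gt0 b_gt0 c_neq0 p1 mS ErlST).
- move=> d' T' P' xi' eta xi'_Stacy eta_iid eta_xi' A mA.
  by rewrite (sumE A mA); exact/esym/(sum_ratio_law xi'_Stacy eta_iid eta_xi' mA).
- move=> d' T' P' xi' theta xi'_Stacy theta_Gamma theta_xi' A mA.
  rewrite (sumE A mA); apply/esym.
  apply: (ratio_law xi'_Stacy _ theta_xi' mA); first exact: measurable_funPT.
  exact: Gamma_n1_Erlang.
- by move=> r r0; exact: (ErlangSt_scale b_gt0 p1 r0 ErlST).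
Qed.
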